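(* Assume the Riemann hypothesis. Let $\Delta>0$ be a sufficiently small fixed number. Then there is a positive function $N(\delta)$, $\delta\in(0,\Delta)$, such that $$\int_2^{N(\delta)}P(x)\,dx=-\frac{a}{\delta}+\mathcal{O}(1),\qquad \delta\in(0,\Delta),\quad a=e^{9/2},$$ where $\mathcal{O}(1)$ stands for a continuous and bounded function of $\delta\in(0,\Delta)$.
   Context: $\pi(x)$ is the prime-counting function, $\operatorname{li}(x)=\int_0^x \frac{dt}{\ln t}$ is the logarithmic integral (the integral is taken as a Cauchy principal value at $t=1$), and $P(x)=\pi(x)-\operatorname{li}(x)$ is the remainder. *)

(* Defs.v *)
From HB Require Import structures.
From mathcomp Require Import all_boot all_order all_algebra.
From mathcomp Require Import complex.
From mathcomp Require Import all_classical all_reals all_analysis.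

Set Implicit Arguments.
Unset Strict Implicit.
Unset Printing Implicit Defensive.
Import Order.TTheory GRing.Theory Num.Theory.
Import numFieldNormedType.Exports.
Local Open Scope classical_set_scope.
Local Open Scope ring_scope.

Definition cexp (R : realType) (z : R[i]) : R[i] :=
  Complex (expR (complex.Re z) * cos (complex.Im z))
          (expR (complex.Re z) * sin (complex.Im z)).

(* The [^o] annotations select the regular normed module structure of [R[i]],
   so that [derivable] at direction 1 is complex differentiability.
   The series is the sum over n >= 1 of n^(-s) = exp (- s * ln n).
   These two conditions determine [zeta] everywhere except at its pole [1],
   where its value is arbitrary. *)
Definition is_riemann_zeta (R : realType) (zeta : R[i] -> R[i]) : Prop :=
  (forall s : R[i], s != 1 ->
     derivable (zeta : (R[i])^o -> (R[i])^o) s 1) /\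
  (forall s : R[i], 1 < complex.Re s ->
     series (fun k : nat => cexp (- s * (ln (k.+1%:R : R))%:C%C) : (R[i])^o)
       @ \oo --> (zeta s : (R[i])^o)).

(* The excluded points -2, -4, -6, ... are the trivial zeros. *)
Definition riemann_hypothesis (R : realType) : Prop :=
  forall zeta : R[i] -> R[i], is_riemann_zeta zeta ->
  forall s : R[i], s != 1 -> zeta s = 0 ->
  (forall k : nat, s != - (k.+1.*2)%:R) -> complex.Re s = 2^-1.

Definition prime_pi (R : realType) (x : R) : R :=
  (\sum_(0 <= p < (Num.truncn x).+1 | prime p) 1)%N%:R.

(* Removing the symmetric interval `]1 - e, 1 + e[ makes this the ordinary
   integral when 0 < x < 1 and the Cauchy principal value when 1 < x.
   At x = 1 the limit does not exist and the value is junk.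
   The integrand is 0 at t = 0, since ln 0 = 0 and 0^-1 = 0. *)
Definition li (R : realType) (x : R) : R :=
  lim ((\int[@lebesgue_measure R]_(t in [set t : R | (0 <= t <= x) && (e <= `|t - 1|)])
          (ln t)^-1 : R) @[e --> (0 : R)^'+]).

Definition remainder (R : realType) (x : R) : R := prime_pi x - li x.

(* Integral from a to b with the usual orientation: at most one of the two
   terms is nonzero, and for b < a the result is minus the integral over
   `[b, a]. *)
Definition oriented_integral (R : realType) (f : R -> R) (a b : R) : R :=
  (\int[@lebesgue_measure R]_(x in `[a, b]) f x
   - \int[@lebesgue_measure R]_(x in `[b, a]) f x).

(* Main.v *)
Require Import Defs.
From HB Require Import structures.
From mathcomp Require Import all_boot all_order all_algebra.
From mathcomp Require Import complex.
From mathcomp Require Import all_classical all_reals all_analysis.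
From mathcomp Require Import measurable_realfun.
From mathcomp Require Import ring lra zify.

Set Implicit Arguments.
Unset Strict Implicit.
Unset Printing Implicit Defensive.
Import Order.TTheory GRing.Theory Num.Theory.
Import numFieldNormedType.Exports.
Local Open Scope classical_set_scope.
Local Open Scope ring_scope.

(* The integral [F x] of the remainder over `[2, x] is continuous, vanishes at 2
   and is unbounded below, so it takes every value [- a / delta], and the bounded
   term can be taken to be 0.

   Suppose [F >= - C] on the integers.  The second difference of [F] at [n] is at
   most [(n is prime) - 1 / ln (n + 1)].  Sum it by parts against
   [w n = ln n * V n], where [V t] is the alternating sum
   [v t - v (2 t) + v (3 t) - ...] and [v] is [2 / sqrt t] smoothly truncated to
   [t <= N ^ 2].  As [w] is convex beyond a fixed point, the sum over primes of
   [ln p * V p] is at least the sum of the [V n] minus a constant, and the latter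
   is [3 / 2 * N * ln 2 + O(1)].
   Summed against the von Mangoldt function, [V] gives the alternating sum of
   [ln n * v n] plus [2 * ln 2] times the sum of the [v (2 n)], which is again at
   most [3 / 2 * N * ln 2 + O(1)].  But the squares of prime powers take a part of
   order [ln N] of this sum away from the primes: a contradiction for large [N]. *)

(** The alternation is aimed at the zeros of the zeta function. It multiplies the Mellin transform
    of [v] by (1 - 2^(1-s)) zeta(s), which cancels the denominator of zeta'/zeta, so the sum over
    prime powers turns into a sum of logarithms over integers. The factor 1 - 2^(1-s) removes the
    pole of zeta at 1. With the plain sum of the v(j t), one side would carry ln n and the other the
    number of divisors of n, which is ln n + 2 gamma on average, and the main terms would differ.
    Here both main terms are ln 2 times 3/2 N, the integral of [v] up to N^2. The exponent 1/2 is
    the one at which prime squares matter: v(p^2) is about 2/p, and the sum of ln p / p grows like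
    ln N. This gain is only logarithmic, so every other estimate has to be exact up to O(1). A sharp
    cut of 2 / sqrt t at N^2 would destroy convexity. An affine correction leaves second differences
    alone and lets weight and slope vanish together at N^2. *)

(** * Calculus of the truncated weight [taper] *)

Lemma is_derive_posX (R : realType) (m : nat) (x : R) :
  is_derive x 1 (fun y : R => Num.max 0 y ^+ m.+2)
    (m.+2%:R * Num.max 0 x ^+ m.+1).
Proof.
case: (ltgtP x 0) => [x0|x0|->].
- rewrite expr0n mulr0.
  apply: (@near_eq_is_derive R R R (cst 0)).
  near=> y; rewrite /= max_l ?expr0n// ltW//; near: y.
  by apply: lt_nbhsl.
- apply: (@near_eq_is_derive R R R (fun y : R => y ^+ m.+2)).
    near=> y; rewrite /= max_r// ltW//; near: y.
    by apply: lt_nbhsr.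
  have := @is_deriveX R R id m.+2 x 1 1 (is_derive_id _ _).
  by rewrite exprfctE scaler1.
- rewrite expr0n mulr0; apply/is_derive1_caratheodory.
  exists (fun y => Num.max 0 y ^+ m.+1); split.
  + move=> y; rewrite maxxx expr0n !subr0 exprSr.
    by case: (leP 0 y) => // y0; rewrite expr0n !mul0r.
  + apply: (@continuous_comp R R R (Num.max 0 : R -> R) (fun y : R => y ^+ m.+1) 0).
      by apply: continuous_max; [exact: cvg_cst|exact: cvg_id].
    exact: exprn_continuous.
  + by rewrite maxxx expr0n.
Unshelve. all: by end_near. Qed.

(** Only monotonicity of the derivative is asked, since the slope of [taper] has a corner at
    [N ^+ 2] and no second derivative there. *)
Lemma second_difference_ge0 (R : realType) (f df : R -> R) (a : R) :
  (forall x, a - 1 <= x <= a + 1 -> is_derive x 1 f (df x)) ->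
  (forall x y, a - 1 <= x -> x <= y -> y <= a + 1 -> df x <= df y) ->
  0 <= f (a + 1) - 2 * f a + f (a - 1).
Proof.
move=> fE dfle.
have cont (u v : R) : a - 1 <= u -> v <= a + 1 -> {within `[u, v], continuous f}.
  move=> ua va; apply: derivable_within_continuous => x.
  rewrite in_itv /= => /andP[ux xv].
  by apply: ex_derive; apply: fE; rewrite (le_trans ua)//= (le_trans xv).
have [|||c] := @MVT R f df (a - 1) a; [lra| |by apply: cont; lra|].
  by move=> x; rewrite in_itv /= => /andP[? ?]; apply: fE; lra.
rewrite in_itv/= => /andP[c1 c2] cE.
have [|||d] := @MVT R f df a (a + 1); [lra| |by apply: cont; lra|].
  by move=> x; rewrite in_itv /= => /andP[? ?]; apply: fE; lra.
rewrite in_itv/= => /andP[d1 d2] dE.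
have : df c <= df d by apply: dfle; lra.
lra.
Qed.

(* With [w = N - z], [w ^+ 2 * (2 * N + z) / (N ^+ 3 * z)] is
   [2 / z + z ^+ 2 / N ^+ 3 - 3 / N],
   that is [2 / sqrt t] corrected by an affine function of [t] so as to vanish
   to second order at [t = N ^+ 2]. *)
Definition taper (R : realType) (N t : R) : R :=
  let z := Num.sqrt t in
  Num.max 0 (N - z) ^+ 2 * (2 * N + z) / (N ^+ 3 * z).

(** Subtracting [N ^- 3], the value of t^(-3/2) at t = N^2, keeps this continuous and nonincreasing
    for t > 0, so [taper] is convex across the cutoff. *)
Definition taper_slope (R : realType) (N t : R) : R :=
  Num.max 0 ((t * Num.sqrt t)^-1 - N ^- 3).

(* The integral of [taper N] over [`[t, N ^+ 2]]. *)
Definition taper_tail (R : realType) (N t : R) : R :=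
  let z := Num.sqrt t in
  Num.max 0 (N - z) ^+ 3 * (3 * N + z) / (2 * N ^+ 3).

Lemma is_derive_posX_sqrt (R : realType) (N t : R) (m : nat) : 0 < t ->
  is_derive t 1 (fun y : R => Num.max 0 (N - Num.sqrt y) ^+ m.+2)
    (- (m.+2%:R * Num.max 0 (N - Num.sqrt t) ^+ m.+1 / (2 * Num.sqrt t))).
Proof.
move=> t0.
have D1 : is_derive t 1 (fun y : R => N - Num.sqrt y) (- (2 * Num.sqrt t)^-1).
  by have := is_deriveB (is_derive_cst N t 1) (is_derive1_sqrt t0); rewrite sub0r.
by have := @is_derive1_comp R _ _ t _ _ (is_derive_posX m (N - Num.sqrt t)) D1; rewrite mulrN.
Qed.

Lemma is_derive_taper (R : realType) (N t : R) : 0 < N -> 0 < t ->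
  is_derive t 1 (taper N) (- taper_slope N t).
Proof.
move=> N0 t0.
have z0 : 0 < Num.sqrt t by rewrite sqrtr_gt0.
have D0 := is_derive_posX_sqrt N 0 t0.
have D1 := is_derive1_sqrt t0.
have D2 : is_derive t 1 (fun y : R => (N ^+ 3 * Num.sqrt y)^-1)
    (- (N ^+ 3 * Num.sqrt t) ^- 2 *: (N ^+ 3 * (2 * Num.sqrt t)^-1)).
  apply: is_deriveV; first by rewrite gt_eqF// mulr_gt0// exprn_gt0.
have D3 : is_derive t 1 (fun y : R => 2 * N + Num.sqrt y) ((2 * Num.sqrt t)^-1).
  by have := is_deriveD (is_derive_cst (2 * N) t 1) D1; rewrite add0r.
have D4 := is_deriveM (is_deriveM D0 D3) D2.
apply: (@is_derive_eq R R R _ _ _ _ _ D4).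
rewrite /GRing.scale/= mulrfctE /taper_slope.
have -> : t * Num.sqrt t = Num.sqrt t ^+ 3 by rewrite exprSr sqr_sqrtr ?ltW.
set z := Num.sqrt t in z0 *.
have w0 : (N - z <= 0) -> z ^- 3 <= N ^- 3.
  by rewrite subr_le0 => Nz; rewrite lef_pV2 ?posrE ?exprn_gt0//;
    apply: lerXn2r; rewrite ?nnegrE// ltW.
have w1 : (0 <= N - z) -> N ^- 3 <= z ^- 3.
  by rewrite subr_ge0 => Nz; rewrite lef_pV2 ?posrE ?exprn_gt0//;
    apply: lerXn2r; rewrite ?nnegrE// ltW.
case: (leP 0 (N - z)) => [/w1 h|/ltW/w0 h].
  rewrite max_r ?subr_ge0//; field; lra.
rewrite max_l ?subr_le0//; field; lra.
Qed.

Lemma is_derive_taper_tail (R : realType) (N t : R) : 0 < N -> 0 < t ->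
  is_derive t 1 (taper_tail N) (- taper N t).
Proof.
move=> N0 t0.
have z0 : 0 < Num.sqrt t by rewrite sqrtr_gt0.
have D0 := is_derive_posX_sqrt N 1 t0.
have D1 := is_derive1_sqrt t0.
have D3 : is_derive t 1 (fun y : R => 3 * N + Num.sqrt y) ((2 * Num.sqrt t)^-1).
  by have := is_deriveD (is_derive_cst (3 * N) t 1) D1; rewrite add0r.
have D4 := is_deriveM (is_deriveM D0 D3) (is_derive_cst ((2 * N ^+ 3)^-1 : R) t 1).
apply: (@is_derive_eq R R R _ _ _ _ _ D4).
rewrite /GRing.scale/= mulrfctE /taper.
set z := Num.sqrt t in z0 *.
case: (leP 0 (N - z)) => h; field; lra.
Qed.

Lemma le_of_derive_le0 (R : realType) (f df : R -> R) (a b : R) : a <= b ->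
  (forall x, a <= x <= b -> is_derive x 1 f (df x)) ->
  (forall x, a <= x <= b -> df x <= 0) -> f b <= f a.
Proof.
rewrite le_eqVlt => /orP[/eqP->//|ab] fE df0.
have [||c] := @MVT R f df a b ab.
- by move=> x; rewrite in_itv/= => /andP[? ?]; apply: fE; rewrite !ltW.
- apply: derivable_within_continuous => x; rewrite in_itv/= => xab.
  by apply: ex_derive; exact: fE.
- rewrite in_itv/= => /andP[ac cb] h; rewrite -subr_le0 h.
  by apply: mulr_le0_ge0; [apply: df0; rewrite !ltW|rewrite subr_ge0 ltW].
Qed.

Lemma taper_slope_ge0 (R : realType) (N t : R) : 0 <= taper_slope N t.
Proof. by rewrite /taper_slope le_max lexx. Qed.

Lemma taper_ge0 (R : realType) (N t : R) : 0 < N -> 0 <= taper N t.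
Proof.
move=> N0; rewrite /taper divr_ge0// mulr_ge0 ?sqrtr_ge0 ?exprn_ge0 ?(ltW N0)//.
  by rewrite le_max lexx.
by rewrite addr_ge0 ?sqrtr_ge0// mulr_ge0// ltW.
Qed.

Lemma taper_anti (R : realType) (N s t : R) : 0 < N -> 0 < s -> s <= t ->
  taper N t <= taper N s.
Proof.
move=> N0 s0 st; apply: (@le_of_derive_le0 R _ (fun x => - taper_slope N x)) => //.
  by move=> x /andP[sx _]; apply: is_derive_taper => //; exact: lt_le_trans sx.
by move=> x _; rewrite oppr_le0 taper_slope_ge0.
Qed.

Lemma taper_eq0 (R : realType) (N t : R) : 0 < N -> N ^+ 2 <= t -> taper N t = 0.
Proof.
move=> N0 Nt; rewrite /taper max_l ?expr0n ?mul0r//.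
by rewrite subr_le0 -[leLHS]gtr0_norm// -sqrtr_sqr ler_wsqrtr.
Qed.

Lemma taper_eq (R : realType) (N t : R) : 0 < N -> 0 < t -> t <= N ^+ 2 ->
  taper N t = 2 / Num.sqrt t + t / N ^+ 3 - 3 / N.
Proof.
move=> N0 t0 tN; have z0 : 0 < Num.sqrt t by rewrite sqrtr_gt0.
rewrite /taper max_r; last first.
  by rewrite subr_ge0 -[leRHS]gtr0_norm// -sqrtr_sqr ler_wsqrtr.
move: z0 (sqr_sqrtr (ltW t0)); move: (Num.sqrt t) => z z0 <-; field; lra.
Qed.

Lemma is_derive_inv_sqrt (R : realType) (t : R) : 0 < t ->
  is_derive t 1 (fun y : R => (Num.sqrt y)^-1) (- (2^-1 / (t * Num.sqrt t))).
Proof.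
move=> t0; have z0 : 0 < Num.sqrt t by rewrite sqrtr_gt0.
have := @is_deriveV R Num.sqrt t _ 1 (lt0r_neq0 z0) (is_derive1_sqrt t0).
move=> D; apply: (@is_derive_eq R R R _ _ _ _ _ D).
rewrite /GRing.scale/=.
move: z0 (sqr_sqrtr (ltW t0)); move: (Num.sqrt t) => z z0 <-; field; lra.
Qed.

(** [taper_slope] never exceeds t^(-3/2), which is minus the derivative of 2 / sqrt t, so 2 / sqrt t
    - [taper] is nonincreasing. *)
Lemma taper_diff_le (R : realType) (N s t : R) : 0 < N -> 0 < s -> s <= t ->
  taper N s - taper N t <= 2 / Num.sqrt s - 2 / Num.sqrt t.
Proof.
move=> N0 s0 st.
suff : 2 / Num.sqrt t - taper N t <= 2 / Num.sqrt s - taper N s by lra.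
apply: (@le_of_derive_le0 R (fun x => 2 / Num.sqrt x - taper N x)
   (fun x => - (x * Num.sqrt x)^-1 + taper_slope N x)) => //.
  move=> x /andP[sx _]; have x0 := lt_le_trans s0 sx.
  have D := is_deriveB (is_deriveM (is_derive_cst (2 : R) x 1) (is_derive_inv_sqrt x0))
     (is_derive_taper N0 x0).
  apply: (@is_derive_eq R R R _ _ _ _ _ D).
  by rewrite /GRing.scale/= mulr0 addr0 opprK; field; rewrite !gt_eqF// sqrtr_gt0.
move=> x /andP[sx _]; rewrite /taper_slope addrC subr_le0 ge_max invr_ge0.
rewrite mulr_ge0 ?sqrtr_ge0 ?(le_trans (ltW s0))//= gerBl invr_ge0 exprn_ge0//.
exact: ltW.
Qed.

Lemma taper_le (R : realType) (N t : R) : 0 < N -> 0 < t ->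
  taper N t <= 2 / Num.sqrt t.
Proof.
move=> N0 t0; have [tN|/ltW Nt] := leP t (N ^+ 2).
  have := taper_diff_le N0 t0 tN; rewrite (taper_eq0 N0 (lexx _)) subr0.
  move=> h; apply: (le_trans h); rewrite gerBl mulr_ge0// invr_ge0 sqrtr_ge0//.
by rewrite taper_eq0// mulr_ge0// invr_ge0 sqrtr_ge0.
Qed.

(** * Consecutive terms of the alternating sum: monotonicity and convexity *)

(** The alternating sum is handled as a sum of such pairs because each pair is by itself
    nonnegative, nonincreasing and convex. *)
Definition gap (R : realType) (N : R) (j : nat) (t : R) : R :=
  taper N (j%:R * t) - taper N (j.+1%:R * t).

Definition gap_slope (R : realType) (N : R) (j : nat) (t : R) : R :=
  j%:R * taper_slope N (j%:R * t) - j.+1%:R * taper_slope N (j.+1%:R * t).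

Lemma is_derive_scale (R : realType) (f : R -> R) (c t df : R) :
  is_derive (c * t) 1 f df -> is_derive t 1 (fun y => f (c * y)) (c * df).
Proof.
move=> D.
have D1 : is_derive t 1 (fun y : R => c * y) c.
  have := is_deriveM (is_derive_cst (c : R) t 1) (is_derive_id (t : R) 1).
  by rewrite scaler0 addr0 /GRing.scale/= mulr1.
have D2 := @is_derive1_comp R f (fun y => c * y) t _ _ D D1.
by apply: (@is_derive_eq R R R _ _ _ _ _ D2); rewrite mulrC.
Qed.

Lemma is_derive_gap (R : realType) (N : R) (j : nat) (t : R) : 0 < N -> 0 < t ->
  (0 < j)%N -> is_derive t 1 (gap N j) (- gap_slope N j t).
Proof.
move=> N0 t0 j0.
have [jt j1t] : 0 < j%:R * t /\ 0 < j.+1%:R * t by rewrite !mulr_gt0 ?ltr0n.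
have D := is_deriveB (is_derive_scale (is_derive_taper N0 jt))
  (is_derive_scale (is_derive_taper N0 j1t)).
apply: (@is_derive_eq R R R _ _ _ _ _ D).
by rewrite /gap_slope; ring.
Qed.

Lemma scaled_taper_slope (R : realType) (N t : R) (j : nat) : 0 < t -> (0 < j)%N ->
  j%:R * taper_slope N (j%:R * t) =
  Num.max 0 ((Num.sqrt j%:R)^-1 * (t * Num.sqrt t)^-1 - j%:R * N ^- 3).
Proof.
move=> t0 j0; have j0' : 0 < j%:R :> R by rewrite ltr0n.
rewrite /taper_slope maxr_pMr ?ltW// mulr0 mulrBr; congr (Num.max 0 (_ - _)).
rewrite sqrtrM ?ltW//.
have [z0 s0] : 0 < Num.sqrt t /\ 0 < Num.sqrt (j%:R : R) by rewrite !sqrtr_gt0.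
by field; rewrite !gt_eqF.
Qed.

(* In the variable [y = t `^ (- 3 / 2)] minus the slope of a gap is a difference
   of two hinge functions, the first one starting earlier and growing faster. *)
Lemma hinge_diff_le (R : realType) (a b e e' y y' : R) :
  0 <= b <= a -> 0 <= e <= e' -> 0 <= y <= y' ->
  0 <= Num.max 0 (a * y - e) - Num.max 0 (b * y - e') /\
  Num.max 0 (a * y - e) - Num.max 0 (b * y - e') <=
  Num.max 0 (a * y' - e) - Num.max 0 (b * y' - e').
Proof.
move=> /andP[b0 ba] /andP[e0 ee] /andP[y0 yy].
have h1 : b * y <= a * y by rewrite ler_wpM2r.
have h2 : b * y' <= a * y' by rewrite ler_wpM2r// (le_trans y0).
have h3 : b * (y' - y) <= a * (y' - y) by rewrite ler_wpM2r// subr_ge0.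
have h4 : 0 <= b * (y' - y) by rewrite mulr_ge0// subr_ge0.
have h5 : 0 <= b * y by rewrite mulr_ge0.
case: (leP 0 (a * y - e)) => ?; case: (leP 0 (b * y - e')) => ?;
case: (leP 0 (a * y' - e)) => ?; case: (leP 0 (b * y' - e')) => ?; lra.
Qed.

Lemma inv_cube_sqrt_anti (R : realType) (s t : R) : 0 < s -> s <= t ->
  0 <= (t * Num.sqrt t)^-1 <= (s * Num.sqrt s)^-1.
Proof.
move=> s0 st; have t0 := lt_le_trans s0 st.
have [z0 z1] : 0 < Num.sqrt s /\ 0 < Num.sqrt t by rewrite !sqrtr_gt0.
rewrite invr_ge0 mulr_ge0 ?(ltW t0) ?(ltW z1)//= lef_pV2 ?posrE ?mulr_gt0//.
by apply: ler_pM; rewrite ?ler_wsqrtr// ltW.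
Qed.

Lemma inv_sqrtn_anti (R : realType) (j : nat) : (0 < j)%N ->
  0 <= (Num.sqrt (j.+1%:R : R))^-1 <= (Num.sqrt (j%:R : R))^-1.
Proof.
move=> j0; rewrite invr_ge0 sqrtr_ge0/= lef_pV2 ?posrE ?sqrtr_gt0 ?ltr0n//.
by rewrite ler_wsqrtr// ler_nat.
Qed.

Lemma gap_slope_anti (R : realType) (N s t : R) (j : nat) : 0 < N -> 0 < s -> s <= t ->
  (0 < j)%N -> 0 <= gap_slope N j t <= gap_slope N j s.
Proof.
move=> N0 s0 st j0; rewrite /gap_slope !scaled_taper_slope//; try exact: lt_le_trans st.
have N3 : 0 <= N ^- 3 by rewrite invr_ge0 exprn_ge0// ltW.
have [] := @hinge_diff_le R _ _ (j%:R * N ^- 3) (j.+1%:R * N ^- 3) _ _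
  (inv_sqrtn_anti R j0) _ (inv_cube_sqrt_anti s0 st).
  by rewrite mulr_ge0//= ler_wpM2r// ler_nat.
by move=> -> ->.
Qed.

Lemma gap_anti (R : realType) (N s t : R) (j : nat) : 0 < N -> 0 < s -> s <= t ->
  (0 < j)%N -> gap N j t <= gap N j s.
Proof.
move=> N0 s0 st j0.
apply: (@le_of_derive_le0 R _ (fun x => - gap_slope N j x)) => //.
  by move=> x /andP[sx _]; apply: is_derive_gap => //; exact: lt_le_trans sx.
move=> x /andP[sx _]; rewrite oppr_le0.
by case/andP: (gap_slope_anti N0 (lt_le_trans s0 sx) (lexx x) j0).
Qed.

Lemma gap_ge0 (R : realType) (N t : R) (j : nat) : 0 < N -> 0 < t ->
  (0 < j)%N -> 0 <= gap N j t.
Proof.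
by move=> *; rewrite subr_ge0 taper_anti ?mulr_gt0 ?ltr0n// ler_wpM2r ?ler_nat// ltW.
Qed.

Lemma gap_second_difference_ge0 (R : realType) (N a : R) (j : nat) : 0 < N -> 1 < a ->
  (0 < j)%N -> 0 <= gap N j (a + 1) - 2 * gap N j a + gap N j (a - 1).
Proof.
move=> N0 a1 j0; apply: (@second_difference_ge0 R _ (fun x => - gap_slope N j x)).
  by move=> x /andP[ax _]; apply: is_derive_gap => //; lra.
move=> x y ax xy ya; rewrite lerN2.
have x0 : 0 < x by lra.
by have /andP[] := gap_slope_anti N0 x0 xy j0.
Qed.

(** Here [x], [z], [y] are the square roots of a - 1, a, a + 1. Over the common denominator the
    numerator is (y - x) z + 2 >= 2, while x y <= z^2, z + x <= 2 z and y + z <= 5/2 z bound the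
    denominator by 5 z^5. *)
Lemma inv_second_difference (R : realType) (x y z : R) : 0 < x -> 0 < y -> 0 < z ->
  x ^+ 2 = z ^+ 2 - 1 -> y ^+ 2 = z ^+ 2 + 1 ->
  2 / 5 / z ^+ 5 <= y^-1 - 2 * z^-1 + x^-1.
Proof.
move=> x0 y0 z0 xE yE.
have -> : y^-1 - 2 * z^-1 + x^-1 =
    (y * (z ^+ 2 - x ^+ 2) * (y + z) - x * (y ^+ 2 - z ^+ 2) * (z + x)) /
    (x * y * z * (z + x) * (y + z)).
  by field; rewrite !gt_eqF ?addr_gt0.
have -> : y * (z ^+ 2 - x ^+ 2) * (y + z) - x * (y ^+ 2 - z ^+ 2) * (z + x) =
    (y - x) * z + 2.
  have -> : z ^+ 2 - x ^+ 2 = 1 by rewrite xE; ring.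
  have -> : y ^+ 2 - z ^+ 2 = 1 by rewrite yE; ring.
  have <- : y ^+ 2 - x ^+ 2 = 2 by rewrite xE yE; ring.
  by ring.
have xz : x <= z by rewrite -(ler_sqr (ltW x0) (ltW z0)) xE; lra.
have yz : z <= y by rewrite -(ler_sqr (ltW z0) (ltW y0)) yE; lra.
have z1 : 1 < z ^+ 2 by have := exprn_gt0 2 x0; lra.
have yz2 : y <= 3 / 2 * z.
  have h : 0 <= 3 / 2 * z by lra.
  rewrite -(ler_sqr (ltW y0) h) yE exprMn; lra.
have xyz : x * y <= z ^+ 2.
  have h1 := mulr_ge0 (ltW x0) (ltW y0); have h2 := exprn_ge0 2 (ltW z0).
  rewrite -(ler_sqr h1 h2) exprMn xE yE; lra.
rewrite ler_pdivlMr ?mulr_gt0 ?addr_gt0//.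
rewrite mulrAC ler_pdivrMr ?exprn_gt0//.
have h1 : x * y * (z * ((z + x) * (y + z))) <= z ^+ 2 * (z * (2 * z * (5 / 2 * z))).
  apply: ler_pM => //; try by rewrite !mulr_ge0 ?addr_ge0 // ltW.
  rewrite ler_pM2l//; apply: ler_pM; lra.
have h2 : 0 <= (y - x) * z * z ^+ 5.
  by rewrite !mulr_ge0 ?exprn_ge0 ?(ltW z0)// subr_ge0 (le_trans xz).
have h3 : z ^+ 2 * (z * (2 * z * (5 / 2 * z))) = 5 * z ^+ 5 by field.
lra.
Qed.

Lemma inv_sqrt_second_difference (R : realType) (a : R) : 1 < a ->
  2 / 5 / Num.sqrt a ^+ 5 <=
  (Num.sqrt (a + 1))^-1 - 2 * (Num.sqrt a)^-1 + (Num.sqrt (a - 1))^-1.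
Proof.
move=> a1; apply: inv_second_difference; rewrite ?sqrtr_gt0 ?sqr_sqrtr//; lra.
Qed.

(** Put b = 1 / sqrt 2, n = N^(-3) and y = t^(-3/2). Up to N^2, subtracting 2 (1 - b) / sqrt t from
    the first gap leaves a function with derivative max(n - b y, - n), which is nondecreasing in t.
    The gap is thus at least as convex as 2 (1 - b) / sqrt t, and 2 (1 - b) >= 1/2 turns the
    constant 2/5 into 1/5. *)
Lemma gap1_second_difference (R : realType) (N a : R) : 0 < N -> 1 < a ->
  a + 1 <= N ^+ 2 ->
  1 / 5 / Num.sqrt a ^+ 5 <= gap N 1 (a + 1) - 2 * gap N 1 a + gap N 1 (a - 1).
Proof.
move=> N0 a1 aN.
pose b : R := (Num.sqrt 2%:R)^-1.
have b0 : 0 < b by rewrite invr_gt0 sqrtr_gt0.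
have b2 : b ^+ 2 = 2^-1 by rewrite exprVn sqr_sqrtr.
have b1 : b <= 3 / 4 by rewrite leNgt; apply/negP => h; nra.
have N3 : 0 < N ^- 3 by rewrite invr_gt0 exprn_gt0.
have z5 : 0 < (Num.sqrt a ^+ 5)^-1 by rewrite invr_gt0 exprn_gt0// sqrtr_gt0; lra.
suff : 0 <= (gap N 1 (a + 1) - 2 * (1 - b) * (Num.sqrt (a + 1))^-1)
  - 2 * (gap N 1 a - 2 * (1 - b) * (Num.sqrt a)^-1)
  + (gap N 1 (a - 1) - 2 * (1 - b) * (Num.sqrt (a - 1))^-1).
  have := inv_sqrt_second_difference a1.
  move=> h1 h2; have h3 := ler_wpM2l (_ : 0 <= 2 * (1 - b)) h1.
  have {}h3 := h3 ltac:(lra).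
  have : 0 <= (3 / 4 - b) * (Num.sqrt a ^+ 5)^-1 by rewrite mulr_ge0 ?(ltW z5)// subr_ge0.
  lra.
apply: (@second_difference_ge0 R
  (fun x => gap N 1 x - 2 * (1 - b) * (Num.sqrt x)^-1)
  (fun x => - gap_slope N 1 x + (1 - b) * (x * Num.sqrt x)^-1) a).
  move=> x /andP[ax xa]; have x0 : 0 < x by lra.
  have z0 : 0 < Num.sqrt x by rewrite sqrtr_gt0.
  have D := is_deriveB (@is_derive_gap R N 1 x N0 x0 isT)
    (is_deriveM (is_derive_cst (2 * (1 - b) : R) x 1) (is_derive_inv_sqrt x0)).
  apply: (@is_derive_eq R R R _ _ _ _ _ D).
  by rewrite /GRing.scale/= mulr0 addr0; field; rewrite !gt_eqF.
move=> x y ax xy ya.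
have x0 : 0 < x by lra. have y0 := lt_le_trans x0 xy.
have w : N ^- 3 <= (y * Num.sqrt y)^-1.
  have yN := le_trans ya aN.
  have N2 : 0 < N ^+ 2 by rewrite exprn_gt0.
  have /andP[_] := inv_cube_sqrt_anti y0 yN.
  by rewrite sqrtr_sqr gtr0_norm// -exprSr.
rewrite /gap_slope !scaled_taper_slope// sqrtr1 invr1 !mul1r -/b.
have := inv_cube_sqrt_anti x0 xy; move: w.
move: ((x * Num.sqrt x)^-1) ((y * Num.sqrt y)^-1) (N ^- 3) N3 => p q n n0 nq /andP[q0 qp].
have h : b * q <= b * p by rewrite ler_wpM2l// ltW.
by case: (leP 0 (p - n)) => ?; case: (leP 0 (q - n)) => ?;
  case: (leP 0 (b * p - 2 * n)) => ?; case: (leP 0 (b * q - 2 * n)) => ?; lra.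
Qed.

(** * The alternating sum and the convexity of its product with the logarithm *)

(** When N^2 = 2 k and t >= 1, the terms [taper N (j * t)] with j > 2 k vanish, so these k pairs are
    the whole alternating sum. *)
Definition alt_taper (R : realType) (N : R) (k : nat) (t : R) : R :=
  \sum_(i < k) gap N i.*2.+1 t.

(** The other pairing of the same terms: the complement is again made of gaps, hence nonnegative and
    nonincreasing. This bounds the alternating sum and its decrements by those of [taper]. *)
Lemma alt_taper_compl (R : realType) (N t : R) (k : nat) :
  taper N t - alt_taper N k.+1 t =
  \sum_(i < k) gap N i.*2.+2 t + taper N (k.+1.*2%:R * t).
Proof.
elim: k => [|k IH].
  by rewrite /alt_taper big_ord0 big_ord1 /gap mul1r add0r; ring.
rewrite /alt_taper big_ord_recr /= -/(alt_taper N k.+1 t) opprD addrA IH.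
by rewrite big_ord_recr /= /gap !doubleS; ring.
Qed.

Lemma alt_taper_ge0 (R : realType) (N t : R) (k : nat) : 0 < N -> 0 < t ->
  0 <= alt_taper N k t.
Proof. by move=> N0 t0; apply: sumr_ge0 => i _; exact: gap_ge0. Qed.

Lemma alt_taper_anti (R : realType) (N s t : R) (k : nat) : 0 < N -> 0 < s ->
  s <= t -> alt_taper N k t <= alt_taper N k s.
Proof. by move=> N0 s0 st; apply: ler_sum => i _; exact: gap_anti. Qed.

Lemma alt_taper_diff_le (R : realType) (N s t : R) (k : nat) : 0 < N -> 0 < s ->
  s <= t -> alt_taper N k.+1 s - alt_taper N k.+1 t <= taper N s - taper N t.
Proof.
move=> N0 s0 st; suff : taper N t - alt_taper N k.+1 t <= taper N s - alt_taper N k.+1 s.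
  by lra.
rewrite !alt_taper_compl lerD//.
  by apply: ler_sum => i _; exact: gap_anti.
by rewrite taper_anti ?mulr_gt0 ?ltr0n// ler_wpM2l.
Qed.

Lemma alt_taper_le (R : realType) (N t : R) (k : nat) : 0 < N -> 0 < t ->
  alt_taper N k.+1 t <= taper N t.
Proof.
move=> N0 t0; rewrite -subr_ge0 alt_taper_compl addr_ge0 ?taper_ge0//.
by apply: sumr_ge0 => i _; exact: gap_ge0.
Qed.

Lemma alt_taper_ge_gap (R : realType) (N t : R) (k : nat) : 0 < N -> 0 < t ->
  gap N 1 t <= alt_taper N k.+1 t.
Proof.
move=> N0 t0; rewrite /alt_taper big_ord_recl lerDl.
by apply: sumr_ge0 => i _; exact: gap_ge0.
Qed.

Lemma alt_taper_second_difference (R : realType) (N a : R) (k : nat) : 0 < N ->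
  1 < a -> a + 1 <= N ^+ 2 ->
  1 / 5 / Num.sqrt a ^+ 5 <=
  alt_taper N k.+1 (a + 1) - 2 * alt_taper N k.+1 a + alt_taper N k.+1 (a - 1).
Proof.
move=> N0 a1 aN; apply: (le_trans (gap1_second_difference N0 a1 aN)).
rewrite /alt_taper !big_ord_recl -subr_ge0.
set s1 := \sum_(i < k) _ (a + 1); set s2 := \sum_(i < k) _ a;
set s3 := \sum_(i < k) _ (a - 1).
rewrite [leRHS](_ : _ = s1 - 2 * s2 + s3); last by ring.
rewrite /s1 /s2 /s3 mulr_sumr -sumrB -big_split/=.
by apply: sumr_ge0 => i _; apply: gap_second_difference_ge0.
Qed.

Lemma inv_sqrt_diff_le (R : realType) (a : R) : 2 <= a ->
  2 / Num.sqrt (a - 1) - 2 / Num.sqrt (a + 1) <= 4 / Num.sqrt a ^+ 3.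
Proof.
suff H (x y z : R) : 0 < x -> 0 < y -> 0 < z -> 2 <= z ^+ 2 ->
    x ^+ 2 = z ^+ 2 - 1 -> y ^+ 2 = z ^+ 2 + 1 -> 2 / x - 2 / y <= 4 / z ^+ 3.
  by move=> a2; apply: H; rewrite ?sqrtr_gt0 ?sqr_sqrtr//; lra.
move=> x0 y0 z0 z2 xE yE.
have -> : 2 / x - 2 / y = 2 * (y ^+ 2 - x ^+ 2) / (x * y * (x + y)).
  by field; rewrite !gt_eqF ?addr_gt0.
have -> : 2 * (y ^+ 2 - x ^+ 2) = 4 by rewrite xE yE; ring.
rewrite ler_pM2l// lef_pV2 ?posrE ?exprn_gt0 ?mulr_gt0 ?addr_gt0//.
(* From z^2 >= 2 one gets x^2 >= z^2 / 2, and 49/100 < 1/2. The final product 7/10 * 17/10 = 119/100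
   is then still above 1. *)
have xz : 7 / 10 * z <= x.
  have h : 0 <= 7 / 10 * z by lra.
  by rewrite -(ler_sqr h (ltW x0)) xE exprMn; lra.
have yz : z <= y by rewrite -(ler_sqr (ltW z0) (ltW y0)) yE; lra.
have h : (7 / 10 * z * z) * (7 / 10 * z + z) <= x * y * (x + y).
  have h0 := mulr_ge0 (ltW z0) (ltW z0).
  have h1 : 7 / 10 * z * z <= x * y by apply: ler_pM; lra.
  by apply: ler_pM => //; lra.
apply: le_trans h.
have -> : 7 / 10 * z * z * (7 / 10 * z + z) = 119 / 100 * z ^+ 3 by field.
by have := exprn_gt0 3 z0; lra.
Qed.

Lemma ln_sub_le (R : realType) (x y : R) : 0 < x -> 0 < y -> ln y - ln x <= (y - x) / x.
Proof.
move=> x0 y0; rewrite -ln_div ?posrE//.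
have -> : y / x = 1 + (y / x - 1) by ring.
apply: (le_trans (le_ln1Dx _)); first by have := divr_gt0 y0 x0; lra.
by rewrite mulrBl divff ?gt_eqF//; lra.
Qed.

(* With [z = sqrt a] the convexity of [alt_taper] is worth [ln a / 5 / z ^+ 5]
   while the terms coming from the variation of [ln] are [O(1 / z ^+ 5)]. *)
Lemma ln_alt_taper_second_difference (R : realType) (N a : R) (k : nat) : 0 < N ->
  2 <= a -> 60 <= ln a -> a + 1 <= N ^+ 2 ->
  0 <= ln (a + 1) * alt_taper N k.+1 (a + 1) - 2 * (ln a * alt_taper N k.+1 a)
       + ln (a - 1) * alt_taper N k.+1 (a - 1).
Proof.
move=> N0 a2 la aN.
have [a0 [am ap]] : 0 < a /\ 0 < a - 1 /\ 0 < a + 1 by lra.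
have := @alt_taper_second_difference R N a k N0 ltac:(lra) aN.
have := @alt_taper_diff_le R N (a - 1) (a + 1) k N0 am ltac:(lra).
have := le_trans (@alt_taper_le R N (a + 1) k N0 ap) (taper_le N0 ap).
have := @alt_taper_ge0 R N (a + 1) k.+1 N0 ap.
have := @alt_taper_anti R N (a - 1) (a + 1) k.+1 N0 am ltac:(lra).
have := @taper_diff_le R N (a - 1) (a + 1) N0 am ltac:(lra).
have := inv_sqrt_diff_le a2.
move: (alt_taper _ _ (a + 1)) (alt_taper _ _ a) (alt_taper _ _ (a - 1)) => u v w.
move: (taper _ _) (taper _ _) => t1 t2 h1 h2 h3 h4 h5 h6 h7.
have z0 : 0 < Num.sqrt a by rewrite sqrtr_gt0.
have zE := sqr_sqrtr (ltW a0).
have zy : (Num.sqrt (a + 1))^-1 <= (Num.sqrt a)^-1.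
  by rewrite lef_pV2 ?posrE ?sqrtr_gt0// ler_wsqrtr//; lra.
pose p := ln (a + 1) - ln a; pose q := ln a - ln (a - 1).
have q1 : q <= 2 / Num.sqrt a ^+ 2.
  apply: (le_trans (ln_sub_le am a0)); rewrite zE.
  rewrite ler_pdivrMr// mulrAC ler_pdivlMr//; lra.
have q0 : 0 <= q by rewrite subr_ge0 ler_ln ?posrE//; lra.
have pq : q - p <= 2 / Num.sqrt a ^+ 4.
  have -> : q - p = ln (a ^+ 2) - ln ((a - 1) * (a + 1)).
    by rewrite lnM ?posrE// expr2 lnM ?posrE// /p /q; ring.
  have apos : 0 < (a - 1) * (a + 1) by rewrite mulr_gt0.
  apply: (le_trans (ln_sub_le apos (exprn_gt0 2 a0))).
  rewrite (exprM _ 2 2) zE ler_pdivrMr// mulrAC ler_pdivlMr ?exprn_gt0//.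
  by nra.
have e1 : q * (w - u) <= 2 / Num.sqrt a ^+ 2 * (4 / Num.sqrt a ^+ 3).
  by apply: ler_pM; lra.
have e2 : (q - p) * u <= 2 / Num.sqrt a ^+ 4 * (2 / Num.sqrt a).
  apply: (@le_trans _ _ (2 / Num.sqrt a ^+ 4 * u)); first by rewrite ler_wpM2r.
  apply: ler_wpM2l; last by lra.
  by rewrite divr_ge0// exprn_ge0// ltW.
have e3 : 60 * (1 / 5 / Num.sqrt a ^+ 5) <= ln a * (u - 2 * v + w).
  by apply: ler_pM => //; rewrite divr_ge0// exprn_ge0// ltW.
(* The threshold 60 on [ln a] comes from this balance: 60 / 5 = 2 * 4 + 2 * 2, the convexity gain
   against the costs [e1] and [e2]. *)
have e4 : 60 * (1 / 5 / Num.sqrt a ^+ 5) =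
   2 / Num.sqrt a ^+ 2 * (4 / Num.sqrt a ^+ 3) + 2 / Num.sqrt a ^+ 4 * (2 / Num.sqrt a).
  by field; rewrite gt_eqF.
have -> : ln (a + 1) * u - 2 * (ln a * v) + ln (a - 1) * w =
   ln a * (u - 2 * v + w) - q * (w - u) - (q - p) * u.
  by rewrite /p /q; ring.
lra.
Qed.

(** * Upper bounds: the alternating sum of [ln n * taper N n], and [taper] over even integers *)

Lemma sum_pairs_le (R : realType) (g : nat -> R) (m k : nat) :
  (forall n, (m.*2 < n)%N -> g n.+1 <= g n) ->
  \sum_(i < k) (g (m + i).*2.+1 - g (m + i).*2.+2) <= g m.*2.+1 - g (m + k).*2.+1.
Proof.
move=> ganti; elim: k => [|k IH]; first by rewrite big_ord0 addn0 subrr.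
rewrite big_ord_recr /= addnS doubleS.
by have := ganti (m + k).*2.+2 ltac:(lia); lra.
Qed.

(** With x = sqrt s this is the decrease of ln x / x beyond e, which follows from the tangent bound
    ln y - ln x <= (y - x) / x. *)
Lemma ln_div_sqrt_anti (R : realType) (s t : R) : 0 < s -> 2 <= ln s -> s <= t ->
  ln t / Num.sqrt t <= ln s / Num.sqrt s.
Proof.
move=> s0 ls st; have t0 := lt_le_trans s0 st.
have x0 : 0 < Num.sqrt s by rewrite sqrtr_gt0.
have y0 : 0 < Num.sqrt t by rewrite sqrtr_gt0.
have lnE (u : R) : 0 < u -> ln u = 2 * ln (Num.sqrt u).
  by move=> u0; rewrite -{1}(sqr_sqrtr (ltW u0)) lnXn ?sqrtr_gt0// mulr_natl.
have h := ln_sub_le x0 y0.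
have xy : Num.sqrt s <= Num.sqrt t by rewrite ler_wsqrtr.
rewrite ler_pdivrMr// mulrAC ler_pdivlMr//.
move: h; rewrite ler_pdivlMr// => h.
have : 0 <= (ln s - 2) * (Num.sqrt t - Num.sqrt s) by rewrite mulr_ge0 ?subr_ge0.
rewrite (lnE s s0) in ls *; rewrite (lnE t t0); lra.
Qed.

Lemma sqrt_taper_anti (R : realType) (N s t : R) : 0 < N -> 0 < s -> s <= t ->
  Num.sqrt t * taper N t <= Num.sqrt s * taper N s.
Proof.
move=> N0 s0 st; have t0 := lt_le_trans s0 st.
have x0 : 0 < Num.sqrt s by rewrite sqrtr_gt0.
have y0 : 0 < Num.sqrt t by rewrite sqrtr_gt0.
have xy : Num.sqrt s <= Num.sqrt t by rewrite ler_wsqrtr.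
have E (u : R) : 0 < Num.sqrt u -> Num.sqrt u * taper N u =
    Num.max 0 (N - Num.sqrt u) ^+ 2 * (2 * N + Num.sqrt u) * N ^- 3.
  by move=> u0; rewrite /taper; field; rewrite !gt_eqF.
rewrite !E// ler_wpM2r ?invr_ge0 ?exprn_ge0 ?(ltW N0)//.
move: (Num.sqrt s) (Num.sqrt t) x0 y0 xy => x y x0 y0 xy.
case: (leP 0 (N - y)) => hy; last first.
  by rewrite expr0n mul0r mulr_ge0 ?sqr_ge0//; lra.
rewrite max_r; last by lra.
rewrite -subr_ge0.
have -> : (N - x) ^+ 2 * (2 * N + x) - (N - y) ^+ 2 * (2 * N + y) =
  (y - x) * ((N - x) * N + (N - y) * (N + x + y) + (N - x) * (N + x)) by ring.
have h1 : 0 <= (N - x) * N by apply: mulr_ge0; lra.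
have h2 : 0 <= (N - y) * (N + x + y) by apply: mulr_ge0; lra.
have h3 : 0 <= (N - x) * (N + x) by apply: mulr_ge0; lra.
by apply: mulr_ge0; lra.
Qed.

Lemma ln_taper_anti (R : realType) (N s t : R) : 0 < N -> 0 < s -> 2 <= ln s ->
  s <= t -> ln t * taper N t <= ln s * taper N s.
Proof.
move=> N0 s0 ls st; have t0 := lt_le_trans s0 st.
have E (u : R) : 0 < u ->
    ln u * taper N u = ln u / Num.sqrt u * (Num.sqrt u * taper N u).
  by move=> u0; field; rewrite gt_eqF ?sqrtr_gt0.
have lt : ln s <= ln t by rewrite ler_ln ?posrE.
rewrite !E//; apply: ler_pM.
- by rewrite divr_ge0 ?sqrtr_ge0//; lra.
- by rewrite mulr_ge0 ?sqrtr_ge0 ?taper_ge0.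
- exact: ln_div_sqrt_anti.
- exact: sqrt_taper_anti.
Qed.

(** 17 is the first index left after eight pairs of the alternating sum. The bound e^2 <= 16 comes
    from e^(1/2) <= 2. *)
Lemma ln17_ge2 (R : realType) : 2 <= ln (17 : R).
Proof.
rewrite -[2]expRK ler_ln ?posrE ?expR_gt0//.
have h : expR (2^-1 : R) <= 2.
  have h1 := expR_ge1Dx (- 2^-1 : R).
  have h2 : expR (2^-1 : R) * expR (- 2^-1) = 1 by rewrite -expRD subrr expR0.
  have := expR_gt0 (2^-1 : R); nra.
have -> : expR (2 : R) = expR 2^-1 ^+ 4 by rewrite -expRM_natl; congr expR; lra.
have : expR (2^-1 : R) ^+ 4 <= 2 ^+ 4 by rewrite lerXn2r ?nnegrE ?expR_ge0.
by rewrite -[X in _ <= X -> _]natrX => /le_trans; apply; rewrite ler_nat.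
Qed.

Lemma ln_taper_le (R : realType) (N : R) (n : nat) : 0 < N -> (0 < n)%N ->
  0 <= ln n%:R * taper N n%:R <= 2 * n%:R.
Proof.
move=> N0 n0; have n1 : 1 <= n%:R :> R by rewrite ler1n.
have l0 := ln_ge0 n1; have t0 : 0 < n%:R :> R by rewrite ltr0n.
rewrite mulr_ge0 ?taper_ge0//= mulrC ler_pM ?taper_ge0//.
  apply: (le_trans (taper_le N0 t0)); rewrite ler_pdivrMr ?sqrtr_gt0// ler_peMr//.
  by rewrite -[leLHS]sqrtr1 ler_wsqrtr.
exact: ltW (ln_sublinear t0).
Qed.

(** Monotonicity is known only where ln n >= 2. The first eight pairs are bounded crudely by 2 * 17
    each, and the alternating remainder by its leading term, again 2 * 17: in all 9 * 34 = 306. *)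
Lemma sum_pairs_ln_taper (R : realType) (N : R) (k : nat) : 0 < N -> (8 <= k)%N ->
  \sum_(i < k) (ln i.*2.+1%:R * taper N i.*2.+1%:R
              - ln i.*2.+2%:R * taper N i.*2.+2%:R) <= 306.
Proof.
move=> N0 /subnK <-; rewrite addnC.
pose g n : R := ln n%:R * taper N n%:R.
rewrite big_split_ord /=.
have h1 : \sum_(i < 8) (g i.*2.+1 - g i.*2.+2) <= \sum_(i < 8) (2 * 17).
  apply: ler_sum => i _; have /andP[_ a] := @ln_taper_le R N i.*2.+1 N0 isT.
  have /andP[b _] := @ln_taper_le R N i.*2.+2 N0 isT.
  have : (i.*2.+1%:R : R) <= 17 by rewrite ler_nat; have := ltn_ord i; lia.
  rewrite /g; lra.
have h2 : \sum_(i < k - 8) (g (8 + i).*2.+1 - g (8 + i).*2.+2) <= 34.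
  apply: (@le_trans _ _ (g 17 - g (8 + (k - 8)).*2.+1)).
    apply: sum_pairs_le => n n17; apply: ln_taper_anti; rewrite ?ltr0n ?ler_nat//; first lia.
    by rewrite (le_trans (ln17_ge2 R))// ler_ln ?posrE ?ltr0n ?ler_nat//; lia.
  have /andP[_ a] := @ln_taper_le R N 17 N0 isT.
  have /andP[b _] := @ln_taper_le R N (8 + (k - 8)).*2.+1 N0 isT.
  rewrite /g; lra.
rewrite sumr_const card_ord in h1; rewrite /g in h1 h2.
by apply: (le_trans (lerD h1 h2)); lra.
Qed.

(** A right-endpoint Riemann sum of step 2 against the antiderivative [F] of [taper], with F(N^2) =
    3/2 N. The increasing part t / N^3 costs 2 / N^3 per step, that is 1 / N over the k steps. *)
Lemma sum_even_taper (R : realType) (N : R) (k : nat) : 0 < N -> N ^+ 2 = k.*2%:R ->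
  \sum_(i < k) taper N i.*2.+2%:R <= 3 / 4 * N + (2 * N)^-1.
Proof.
move=> N0 Nk.
pose F (t : R) := 4 * Num.sqrt t + t ^+ 2 / (2 * N ^+ 3) - 3 * t / N.
have step (i : 'I_k) : 2 * taper N i.*2.+2%:R <= F i.+1.*2%:R - F i.*2%:R + 2 / N ^+ 3.
  have iN : (i.*2.+2%:R : R) <= N ^+ 2 by rewrite Nk ler_nat; have := ltn_ord i; lia.
  have b0 : 0 < (i.*2.+2%:R : R) by rewrite ltr0n.
  rewrite (taper_eq N0 b0 iN) /F doubleS.
  have x0 := sqrtr_ge0 (i.*2%:R : R).
  have y0 : 0 < Num.sqrt (i.*2.+2%:R : R) by rewrite sqrtr_gt0.
  have xy : Num.sqrt (i.*2%:R : R) <= Num.sqrt (i.*2.+2%:R : R).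
    by rewrite ler_wsqrtr// ler_nat; lia.
  have yE := sqr_sqrtr (ltW b0); have xE := sqr_sqrtr (ler0n R i.*2).
  have bE : (i.*2.+2%:R : R) = i.*2%:R + 2 by rewrite -addn2 natrD.
  rewrite bE in yE xy y0 *.
  suff : 1 / Num.sqrt (i.*2%:R + 2 : R) <= Num.sqrt (i.*2%:R + 2 : R) - Num.sqrt i.*2%:R.
    move=> h.
    have -> : (i.*2%:R + 2) ^+ 2 / (2 * N ^+ 3) = i.*2%:R ^+ 2 / (2 * N ^+ 3) +
       2 * (i.*2%:R + 2) / N ^+ 3 - 2 / N ^+ 3 by field; rewrite gt_eqF.
    lra.
  by rewrite ler_pdivrMr//; nra.
have -> : 3 / 4 * N + (2 * N)^-1 = 2^-1 * (F k.*2%:R - F 0 + k%:R * (2 / N ^+ 3)).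
  rewrite /F -Nk sqrtr_sqr gtr0_norm// sqrtr0.
  have -> : (k%:R : R) = N ^+ 2 / 2 by rewrite Nk -mul2n natrM; field.
  by field; rewrite gt_eqF.
have : \sum_(i < k) 2 * taper N i.*2.+2%:R <=
       \sum_(i < k) (F i.+1.*2%:R - F i.*2%:R + 2 / N ^+ 3).
  by apply: ler_sum => i _; exact: step.
rewrite -mulr_sumr big_split /= sumr_const card_ord.
rewrite -(big_mkord xpredT (fun i => F i.+1.*2%:R - F i.*2%:R)) telescope_sumr//.
rewrite double0 mulr_natl; lra.
Qed.

(** * Lower bound for the sum of the alternating weight over the integers *)

Lemma taper_tail_eq0 (R : realType) (N t : R) : 0 < N -> N ^+ 2 <= t ->
  taper_tail N t = 0.
Proof.
move=> N0 Nt; rewrite /taper_tail max_l ?expr0n ?mul0r//.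
by rewrite subr_le0 -[leLHS]gtr0_norm// -sqrtr_sqr ler_wsqrtr.
Qed.

Lemma taper_tail_eq (R : realType) (N t : R) : 0 < N -> 0 <= t -> t <= N ^+ 2 ->
  taper_tail N t = 3 / 2 * N - 4 * Num.sqrt t - t ^+ 2 / (2 * N ^+ 3) + 3 * t / N.
Proof.
move=> N0 t0 tN.
rewrite /taper_tail max_r; last first.
  by rewrite subr_ge0 -[leRHS]gtr0_norm// -sqrtr_sqr ler_wsqrtr.
move: (sqr_sqrtr t0); move: (Num.sqrt t) => z <-; field; lra.
Qed.

(** The integral of [gap N j] from t onwards, since x -> taper(j x) integrates to
    [taper_tail N (j%:R * t) / j%:R]. *)
Definition tail_gap (R : realType) (N : R) (j : nat) (t : R) : R :=
  taper_tail N (j%:R * t) / j%:R - taper_tail N (j.+1%:R * t) / j.+1%:R.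

Lemma is_derive_tail_gap (R : realType) (N t : R) (j : nat) : 0 < N -> 0 < t ->
  (0 < j)%N -> is_derive t 1 (tail_gap N j) (- gap N j t).
Proof.
move=> N0 t0 j0.
have [jt j1t] : 0 < j%:R * t /\ 0 < j.+1%:R * t by rewrite !mulr_gt0 ?ltr0n.
have D := is_deriveB
  (is_deriveM (is_derive_scale (is_derive_taper_tail N0 jt))
    (is_derive_cst (j%:R^-1 : R) t 1))
  (is_deriveM (is_derive_scale (is_derive_taper_tail N0 j1t))
    (is_derive_cst (j.+1%:R^-1 : R) t 1)).
apply: (@is_derive_eq R R R _ _ _ _ _ D).
by rewrite /gap /GRing.scale/= !mulr0 !add0r !mulKf ?pnatr_eq0 -?lt0n//; ring.
Qed.

Lemma tail_gap_diff_le (R : realType) (N t : R) (j : nat) : 0 < N -> 0 < t ->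
  (0 < j)%N -> tail_gap N j t - tail_gap N j (t + 1) <= gap N j t.
Proof.
move=> N0 t0 j0.
suff : - tail_gap N j (t + 1) - gap N j t * (t + 1) <= - tail_gap N j t - gap N j t * t.
  by lra.
apply: (@le_of_derive_le0 R (fun x => - tail_gap N j x - gap N j t * x)
  (fun x => gap N j x - gap N j t)); first lra.
  move=> x /andP[tx _]; have x0 := lt_le_trans t0 tx.
  have D := is_deriveB (is_deriveN (is_derive_tail_gap N0 x0 j0))
    (is_deriveM (is_derive_cst (gap N j t : R) x 1) (is_derive_id (x : R) 1)).
  apply: (@is_derive_eq R R R _ _ _ _ _ D).
  by rewrite /GRing.scale/= mulr0 addr0 mulr1 opprK.
by move=> x /andP[tx _]; rewrite subr_le0 gap_anti.
Qed.

Lemma sum_gap_ge (R : realType) (N : R) (j X : nat) : 0 < N -> N ^+ 2 = X%:R ->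
  (0 < j)%N -> tail_gap N j 1 <= \sum_(1 <= n < X.+1) gap N j n%:R.
Proof.
move=> N0 NX j0.
have tX : tail_gap N j X.+1%:R = 0.
  have h (i : nat) : (0 < i)%N -> N ^+ 2 <= i%:R * X.+1%:R.
    by move=> i0; rewrite NX -natrM ler_nat; nia.
  by rewrite /tail_gap !taper_tail_eq0 ?h// !mul0r subrr.
have T := @telescope_sumr R 1 X.+1 (fun n => - tail_gap N j n%:R) isT.
rewrite tX oppr0 opprK add0r in T; rewrite -[leLHS]T.
apply: ler_sum_nat => n /andP[n1 _]; rewrite opprK addrC -natr1.
by apply: tail_gap_diff_le => //; rewrite ltr0n.
Qed.

(** The Botez-Catalan identity. It turns the alternating harmonic sum into a block that compares
    directly with a difference of logarithms. *)
Lemma alt_harmonic (R : realType) (k : nat) :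
  \sum_(i < k) (i.*2.+1%:R^-1 - i.*2.+2%:R^-1 : R) =
  \sum_(k.+1 <= n < k.*2.+1) n%:R^-1.
Proof.
elim: k => [|k IH]; first by rewrite big_ord0 big_geq.
rewrite big_ord_recr /= IH doubleS.
have E : \sum_(k.+1 <= n < k.*2.+3) (n%:R^-1 : R) =
    k.+1%:R^-1 + \sum_(k.+2 <= n < k.*2.+3) n%:R^-1 by rewrite big_ltn//; lia.
rewrite big_nat_recr in E; last lia.
rewrite big_nat_recr /= in E; last lia.
have h : (k.*2.+2%:R^-1 : R) = 2^-1 * k.+1%:R^-1.
  by rewrite -invfM -natrM; congr (_%:R^-1); lia.
rewrite h in E *; apply: (@addrI _ (k.+1%:R^-1)); rewrite -E.
by move: (\sum_(_ <= _ < k.*2.+1) _) (k.*2.+1%:R^-1) (k.+1%:R^-1) => a b c; lra.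
Qed.

(** An error of order 1 / k is essential: it is later multiplied by 3/2 N with N^2 = 2 k and must
    stay bounded. *)
Lemma alt_harmonic_ge (R : realType) (k : nat) :
  ln 2 - k.*2.+1%:R^-1 <= \sum_(i < k) (i.*2.+1%:R^-1 - i.*2.+2%:R^-1 : R).
Proof.
rewrite alt_harmonic.
have h : ln k.*2.+1%:R - ln k.+1%:R <= \sum_(k.+1 <= n < k.*2.+1) (n%:R^-1 : R).
  have T := @telescope_sumr R k.+1 k.*2.+1 (fun n => ln (n%:R : R)) ltac:(lia).
  rewrite -T.
  apply: ler_sum_nat => n /andP[n1 _].
  apply: (le_trans (ln_sub_le _ _)); rewrite ?ltr0n//; first lia.
  by rewrite -natr1 addrAC subrr add0r mul1r.
apply: le_trans h.
have := @ln_sub_le R k.*2.+1%:R k.*2.+2%:R ltac:(by rewrite ltr0n) ltac:(by rewrite ltr0n).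
have -> : (k.*2.+2%:R : R) = 2 * k.+1%:R by rewrite -natrM -mul2n; congr _%:R; lia.
rewrite lnM ?posrE ?ltr0n//.
have -> : (2 * k.+1%:R - k.*2.+1%:R : R) = 1.
  by rewrite -natr1 -[in X in _ - X]natr1 -mul2n natrM; ring.
rewrite mul1r; move: (ln (2 : R)) (ln _) (ln _) (_^-1) => a b c d; lra.
Qed.

(** Summed over n, the pair of index j contributes 3/2 N (1/j - 1/(j+1)), whence ln 2. The
    alternating sum of the 4 / sqrt j costs at most 4 and the error in ln 2 at most 3/2. *)
Lemma sum_alt_taper_ge (R : realType) (N : R) (k : nat) : 1 <= N -> N ^+ 2 = k.*2%:R ->
  3 / 2 * N * ln 2 - 6 <= \sum_(1 <= n < k.*2.+1) alt_taper N k n%:R.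
Proof.
move=> N1 Nk; have N0 : 0 < N by lra.
rewrite /alt_taper exchange_big /=.
apply: (@le_trans _ _ (\sum_(i < k) tail_gap N i.*2.+1 1)); last first.
  by apply: ler_sum => i _; exact: sum_gap_ge.
have E (i : 'I_k) : tail_gap N i.*2.+1 1 =
   3 / 2 * N * (i.*2.+1%:R^-1 - i.*2.+2%:R^-1) + (2 * N ^+ 3)^-1
   - 4 * ((Num.sqrt i.*2.+1%:R)^-1 - (Num.sqrt i.*2.+2%:R)^-1).
  have H (j : nat) : (0 < j)%N -> (j <= k.*2)%N -> taper_tail N (j%:R * 1) / j%:R =
     3 / 2 * N * j%:R^-1 - 4 * (Num.sqrt j%:R)^-1 - j%:R / (2 * N ^+ 3) + 3 / N.
    move=> j0 jk; have jR : 0 < (j%:R : R) by rewrite ltr0n.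
    rewrite mulr1 taper_tail_eq ?ler0n// ?Nk ?ler_nat//.
    have z0 : 0 < Num.sqrt (j%:R : R) by rewrite sqrtr_gt0.
    move: z0 (sqr_sqrtr (ltW jR)); move: (Num.sqrt _) jR => z jR z0 zE; rewrite -zE.
    by field; rewrite !gt_eqF.
  rewrite /tail_gap !H//; try (have := ltn_ord i; lia).
  have -> : (i.*2.+2%:R : R) / (2 * N ^+ 3) = i.*2.+1%:R / (2 * N ^+ 3) + (2 * N ^+ 3)^-1.
    by rewrite -[in LHS]natr1 mulrDl mul1r.
  ring.
rewrite (eq_bigr _ (fun i _ => E i)) sumrB big_split /= -!mulr_sumr.
have h1 := alt_harmonic_ge R k.
have h2 : \sum_(i < k) ((Num.sqrt i.*2.+1%:R)^-1 - (Num.sqrt i.*2.+2%:R)^-1) <= 1 :> R.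
  apply: (@le_trans _ _ ((Num.sqrt (0.*2.+1%:R : R))^-1 - (Num.sqrt (0 + k).*2.+1%:R)^-1)).
    apply: (@sum_pairs_le R (fun n => (Num.sqrt n%:R)^-1) 0 k).
    by move=> n n0; have /andP[] := inv_sqrtn_anti R n0.
  rewrite sqrtr1 invr1.
  by rewrite gerBl invr_ge0 sqrtr_ge0.
have h3 : 0 <= \sum_(i < k) (2 * N ^+ 3)^-1.
  by apply: sumr_ge0 => i _; rewrite invr_ge0 mulr_ge0// exprn_ge0// ltW.
have h4 : N * k.*2.+1%:R^-1 <= 1.
  rewrite ler_pdivrMr ?ltr0n// mul1r -natr1 -Nk expr2; nra.
have h5 := ler_wpM2l (ltW N0) h1.
have L (a b c d e : R) : a <= 1 -> 0 <= b -> N * d <= 1 -> N * (e - d) <= N * c ->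
    3 / 2 * N * e - 6 <= 3 / 2 * N * c + b - 4 * a by lra.
exact: L h2 h3 h4 h5.
Qed.

(** * Sums over prime powers and the contribution of their squares *)

(* The sum of [f q] over prime powers [q = p ^ e], weighted by the von Mangoldt
   function [ln p], with [p] and [e] both smaller than [B]. *)
Definition prime_power_sum (R : realType) (B : nat) (f : nat -> R) : R :=
  \sum_(p < B | prime p) \sum_(1 <= e < B) ln p%:R * f (p ^ e)%N.

Lemma ln_prime_ge0 (R : realType) (p : nat) : prime p -> 0 <= ln (p%:R : R).
Proof. by move=> pp; rewrite ln_ge0// ler1n prime_gt0. Qed.

Lemma prime_power_sum_le (R : realType) (B : nat) (f g : nat -> R) :
  (forall q, (0 < q)%N -> f q <= g q) -> prime_power_sum B f <= prime_power_sum B g.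
Proof.
move=> fg; apply: ler_sum => p pp; apply: ler_sum => e _.
by rewrite ler_wpM2l ?ln_prime_ge0// fg// expn_gt0 prime_gt0.
Qed.

Lemma prime_power_sumZ (R : realType) (B : nat) (c : R) (f : nat -> R) :
  prime_power_sum B (fun q => c * f q) = c * prime_power_sum B f.
Proof.
rewrite /prime_power_sum mulr_sumr; apply: eq_bigr => p _; rewrite mulr_sumr.
by apply: eq_bigr => e _; rewrite mulrCA.
Qed.

Lemma prime_power_sum_sum (R : realType) (B a b : nat) (f : nat -> nat -> R) :
  prime_power_sum B (fun q => \sum_(a <= n < b) f n q) =
  \sum_(a <= n < b) prime_power_sum B (f n).
Proof.
rewrite /prime_power_sum [RHS]exchange_big /=; apply: eq_bigr => p _.
rewrite [RHS]exchange_big /=; apply: eq_bigr => e _.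
by rewrite mulr_sumr.
Qed.

Lemma ln_prod_nat (R : realType) (I : Type) (s : seq I) (P : pred I) (F : I -> nat) :
  (forall i, P i -> (0 < F i)%N) ->
  ln ((\prod_(i <- s | P i) F i)%N%:R : R) = \sum_(i <- s | P i) ln (F i)%:R.
Proof.
move=> F0; suff [] : ln ((\prod_(i <- s | P i) F i)%N%:R : R) =
    \sum_(i <- s | P i) ln (F i)%:R /\ (0 < \prod_(i <- s | P i) F i)%N by [].
apply: (big_rec2 (fun x y => ln (x%:R : R) = y /\ (0 < x)%N)); first by rewrite ln1.
move=> i y x Pi [IH x0]; have y0 := F0 i Pi.
by rewrite natrM lnM ?posrE ?ltr0n// IH muln_gt0 y0.
Qed.

Lemma sum_leq_nat (B l : nat) : (\sum_(1 <= e < B.+1) (e <= l) = minn B l)%N.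
Proof.
elim: B => [|B IH]; first by rewrite big_geq// min0n.
by rewrite big_nat_recr//= IH; case: leqP => h; lia.
Qed.

(** The von Mangoldt function sums to ln n over the divisors of n: each p occurs [logn p n] times.
    As n < B, no prime power dividing n escapes the bounds on p and e. *)
Lemma prime_power_sum_dvd (R : realType) (B n : nat) : (0 < n < B)%N ->
  prime_power_sum B (fun q => (q %| n)%:R) = ln (n%:R : R).
Proof.
case: B => [|B] /andP[n0 nB]; first by [].
rewrite -[in RHS](partnT n0) (@widen_partn B)//.
rewrite ln_prod_nat; last by move=> p _; case: p => [|p]; rewrite ?expn_gt0// lognE.
rewrite big_mkord [RHS](bigID (fun p : 'I_B.+1 => prime p)) /= addrC big1 ?add0r; last first.
  by move=> p /negbTE np; rewrite lognE np expn0 ln1.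
apply: eq_bigr => p pp; rewrite -mulr_sumr natrX lnXn ?ltr0n ?prime_gt0//.
rewrite -[RHS]mulr_natr; congr (_ * _).
have lB : (logn p n <= B)%N by rewrite -ltnS (ltn_trans (ltn_logl p n0)).
rewrite -natr_sum; congr (_%:R).
rewrite (eq_bigr (fun e => (e <= logn p n)%N : nat)); last first.
  by move=> e _; rewrite pfactor_dvdn.
by rewrite sum_leq_nat; apply/minn_idPr.
Qed.

Lemma sum_multiples (R : realType) (B q : nat) (f : nat -> R) : (0 < q)%N ->
  (forall n, (B <= n)%N -> f n = 0) ->
  \sum_(1 <= j < B) f (j * q)%N = \sum_(1 <= n < B) f n * (q %| n)%:R.
Proof.
move=> q0 fB.
have E j : (0 < j)%N -> f (j * q)%N = \sum_(1 <= n < B) f n * (n == j * q)%N%:R.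
  move=> j0; case: (ltnP (j * q) B) => jB; last first.
    rewrite fB// big_nat big1// => n /andP[_ nB].
    by rewrite ltn_eqF ?mulr0// (leq_trans nB).
  rewrite (big_rem (j * q)%N) /=; last by rewrite mem_index_iota jB muln_gt0 j0 q0.
  rewrite eqxx mulr1 big_seq_cond big1 ?addr0// => n.
  rewrite mem_rem_uniq ?iota_uniq// inE /= => /andP[/andP[/negbTE-> _] _].
  by rewrite mulr0.
rewrite [LHS](_ : _ = \sum_(1 <= j < B) \sum_(1 <= n < B) f n * (n == j * q)%N%:R); last first.
  by apply: eq_big_nat => j /andP[j0 _]; exact: E.
rewrite exchange_big /=; apply: eq_big_nat => n /andP[n0 nB].
rewrite -mulr_sumr; congr (_ * _).
have [/dvdnP[j jE]|nd] := boolP (q %| n)%N; last first.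
  apply: big1 => j _; case: eqP => // nE.
  by rewrite nE dvdn_mull in nd.
have j0 : (0 < j)%N by rewrite lt0n; apply/eqP => j0; rewrite jE j0 in n0.
have jB : (j < B)%N by apply: leq_ltn_trans nB; rewrite jE leq_pmulr.
rewrite (big_rem j) /=; last by rewrite mem_index_iota j0 jB.
rewrite jE eqxx big_seq_cond big1 ?addr0// => i.
rewrite mem_rem_uniq ?iota_uniq// inE /= => /andP[/andP[ij _] _].
by rewrite eqn_pmul2r// eq_sym (negbTE ij).
Qed.

(** Sorting the products j q by their value n collects at n the von Mangoldt function over the
    divisors of n, that is ln n. *)
Lemma prime_power_sum_multiples (R : realType) (B : nat) (f : nat -> R) :
  (forall n, (B <= n)%N -> f n = 0) ->
  prime_power_sum B (fun q => \sum_(1 <= j < B) f (j * q)%N) =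
  \sum_(1 <= n < B) ln n%:R * f n.
Proof.
move=> fB.
transitivity (prime_power_sum B (fun q => \sum_(1 <= n < B) f n * (q %| n)%:R)).
  apply: eq_bigr => p pp; apply: eq_bigr => e _; congr (_ * _).
  by apply: sum_multiples => //; rewrite expn_gt0 prime_gt0.
rewrite prime_power_sum_sum; apply: eq_big_nat => n nB.
by rewrite (prime_power_sumZ _ (f n)) prime_power_sum_dvd// mulrC.
Qed.

Lemma odd_even_sum_le (R : realType) (g : nat -> R) (T : nat) :
  (forall e, 0 <= g e) -> (0 < T)%N ->
  g 1%N + \sum_(1 <= e < T) g e.*2 <= \sum_(1 <= e < T.*2) g e.
Proof.
move=> g0; case: T => // T _; elim: T => [|T IH].
  by rewrite big_geq// addr0 big_ltn// big_geq// addr0.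
have -> : T.+2.*2 = T.+1.*2.+2 by rewrite doubleS.
have S2 d : (0 < d)%N ->
    \sum_(1 <= e < d.+2) g e = \sum_(1 <= e < d) g e + g d + g d.+1.
  by move=> d0; rewrite !big_nat_recr.
have S1 : \sum_(1 <= e < T.+2) g e.*2 = \sum_(1 <= e < T.+1) g e.*2 + g T.+1.*2.
  by rewrite big_nat_recr.
rewrite S1 S2 ?double_gt0// !addrA; have := g0 T.+1.*2.+1; lra.
Qed.

(** Exponent 1 and the even exponents are kept, the other odd ones dropped. The even ones form the
    sum over squares of prime powers, and [T.*2 <= B] makes room for the doubled exponents. *)
Lemma prime_power_sum_ge (R : realType) (B T : nat) (f : nat -> R) :
  (forall q, (0 < q)%N -> 0 <= f q) -> (0 < T)%N -> (T.*2 <= B)%N ->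
  \sum_(p < B | prime p) ln p%:R * f p + prime_power_sum T (fun q => f (q ^ 2)%N)
  <= prime_power_sum B f.
Proof.
move=> f0 T0 TB; have TB' : (T <= B)%N by lia.
have fp (p e : nat) : prime p -> 0 <= ln (p%:R : R) * f (p ^ e)%N.
  by move=> pp; rewrite mulr_ge0 ?ln_prime_ge0// f0// expn_gt0 prime_gt0.
have h : prime_power_sum T (fun q => f (q ^ 2)%N) <=
   \sum_(p < B | prime p) \sum_(1 <= e < T) ln p%:R * f (p ^ e.*2)%N.
  rewrite /prime_power_sum.
  rewrite (big_ord_widen_cond B prime (fun p => \sum_(1 <= e < T) ln p%:R * f ((p ^ e) ^ 2)%N))//.
  rewrite [leLHS]big_mkcondr /=; apply: ler_sum => p pp.
  case: ifP => _; last by apply: sumr_ge0 => e _; exact: fp.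
  by apply: ler_sum => e _; rewrite -expnM muln2.
apply: (le_trans (lerD (lexx _) h)); rewrite -big_split /=.
apply: ler_sum => p pp.
have := @odd_even_sum_le R (fun e => ln p%:R * f (p ^ e)%N) T (fun e => fp p e pp) T0.
rewrite expn1 => /le_trans; apply.
rewrite [leRHS](@big_cat_nat _ _ _ T.*2)//=; last by lia.
by rewrite lerDl; apply: sumr_ge0 => e _; exact: fp.
Qed.

Lemma sum_ln_ge (R : realType) (M : nat) : (0 < M)%N ->
  M%:R * ln M%:R - M%:R <= \sum_(1 <= n < M.+1) ln (n%:R : R).
Proof.
case: M => // M _; elim: M => [|M IH].
  by rewrite big_nat1 ln1 mulr0 sub0r; lra.
rewrite big_nat_recr//=; apply: le_trans (lerD IH (lexx _)).
have a0 : 0 < (M.+1%:R : R) by rewrite ltr0n.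
have b0 : 0 < (M.+2%:R : R) by rewrite ltr0n.
have L (x y z : R) : (y - x) * z <= z + 1 - z -> (z + 1) * y - (z + 1) <= z * x - z + y.
  by lra.
have := ln_sub_le a0 b0; rewrite ler_pdivlMr//.
by move: (ln _) => y; rewrite -[M.+2%:R]natr1; exact: L.
Qed.

Lemma sum_dvdn (M q : nat) : (0 < q)%N -> (\sum_(1 <= n < M.+1) (q %| n) = M %/ q)%N.
Proof.
move=> q0; elim: M => [|M IH]; first by rewrite big_geq// div0n.
by rewrite big_nat_recr//= IH divnS// addnC.
Qed.

(** The lower half of Mertens' first theorem, by Chebyshev's argument: ln M! is the sum over q of
    the von Mangoldt function times the floor of M / q, and ln M! >= M ln M - M. *)
Lemma prime_power_sum_inv_ge (R : realType) (M : nat) : (0 < M)%N ->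
  ln M%:R - 1 <= prime_power_sum M.+1 (fun q => (q <= M)%N%:R / q%:R) :> R.
Proof.
move=> M0; have M0' : 0 < (M%:R : R) by rewrite ltr0n.
have := sum_ln_ge R M0.
rewrite (eq_big_nat _ _ (F2 := fun n => prime_power_sum M.+1 (fun q => (q %| n)%:R))); last first.
  by move=> n /andP[n0 nM]; rewrite prime_power_sum_dvd// n0.
rewrite -prime_power_sum_sum => h.
rewrite -(ler_pM2l M0') -prime_power_sumZ mulrBr mulr1; apply: (le_trans h).
apply: prime_power_sum_le => q q0.
rewrite -natr_sum sum_dvdn//; case: (leqP q M) => qM; last first.
  by rewrite divn_small// mul0r mulr0.
by rewrite mul1r ler_pdivlMr ?ltr0n// -natrM ler_nat leq_trunc_div.
Qed.

(** * The logarithmic integral: removal of the pole and derivative *)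

Lemma bounded_integrable_itv (R : realType) (D : set R) (a b M : R) (f : R -> R) :
  measurable D -> D `<=` `[a, b] -> measurable_fun D f ->
  (forall x, D x -> `|f x| <= M) ->
  (@lebesgue_measure R).-integrable D (EFin \o f).
Proof.
move=> mD Dab mf fM; apply: measurable_bounded_integrable => //.
  apply: (@le_lt_trans _ _ (@lebesgue_measure R `[a, b])).
    by apply: le_measure => //; rewrite inE//; exact: measurable_itv.
  by rewrite lebesgue_measure_itv; case: ifP => // _; rewrite /= ltry.
by exists M; split; [exact: num_real|move=> y My x Dx; apply: le_trans (fM x Dx) (ltW My)].
Qed.

Lemma measurable_inv (R : realType) : measurable_fun [set: R] (fun x : R => x^-1).
Proof.
(* [powR_inv1] concerns nonnegative numbers, so the sign is restored through x^-1 = x * |x|^-2; at 0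
   both sides are 0. *)
rewrite (_ : (fun x : R => x^-1) = (fun x => x * (`|x| `^ (-1)) ^+ 2)); last first.
  apply/funext => x; rewrite powR_inv1// exprVn.
  rewrite real_normK ?num_real//; have [->|x0] := eqVneq x 0.
    by rewrite invr0 mul0r.
  by field.
apply: measurable_funM => //; apply: measurable_funX.
apply: (measurableT_comp (measurable_powR (-1))).
exact: normr_measurable.
Qed.

(** 1 / ln t with its pole at 1 subtracted. As this is bounded, the principal value only concerns 1
    / (t - 1), which integrates explicitly. *)
Definition log_defect (R : realType) (t : R) : R := (ln t)^-1 - (t - 1)^-1.

Lemma measurable_log_defect (R : realType) (D : set R) : measurable_fun D (@log_defect R).
Proof.
apply: measurable_funTS; apply: measurable_funB.
  exact: (measurableT_comp (@measurable_inv R) (@measurable_ln R)).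
by apply: (measurableT_comp (@measurable_inv R)); exact: measurable_funB.
Qed.

(* [1 - 1 / t <= ln t <= t - 1]; the junk values at [0] and [1] satisfy the
   same bounds. *)
Lemma log_defect_bounds (R : realType) (t : R) : 0 <= t -> 0 <= log_defect t <= 1.
Proof.
rewrite le_eqVlt => /predU1P[<-|t0].
  rewrite /log_defect ln0// invr0 !sub0r invrN invr1 opprK lexx andbT; lra.
have h1 : ln t <= t - 1.
  by have := @le_ln1Dx R (t - 1); rewrite [1 + _]addrC subrK; apply; lra.
have h2 : 1 - t^-1 <= ln t.
  have := @le_ln1Dx R (t^-1 - 1); rewrite [1 + _]addrC subrK lnV ?posrE// => h.
  by have := h ltac:(have : 0 < t^-1 by rewrite invr_gt0; lra); lra.
have h2' : 1 - t^-1 = (t - 1) / t by field; rewrite gt_eqF.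
rewrite h2' in h2; rewrite /log_defect.
case: (ltgtP t 1) => t1.
- have l0 : ln t < 0 by apply: le_lt_trans h1 _; lra.
  have E : (ln t)^-1 - (t - 1)^-1 = ((t - 1) - ln t) / (ln t * (t - 1)).
    by field; apply/andP; split; apply: ltr0_neq0; lra.
  have p : 0 < ln t * (t - 1) by rewrite nmulr_rgt0//; lra.
  rewrite E divr_ge0 ?(ltW p) ?subr_ge0//= ler_pdivrMr// mul1r.
  by rewrite ler_pdivrMr// in h2; nra.
- have l0 : 0 < ln t by rewrite ln_gt0.
  have E : (ln t)^-1 - (t - 1)^-1 = ((t - 1) - ln t) / (ln t * (t - 1)).
    by field; apply/andP; split; apply: lt0r_neq0; lra.
  have p : 0 < ln t * (t - 1) by rewrite mulr_gt0//; lra.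
  rewrite E divr_ge0 ?(ltW p) ?subr_ge0//= ler_pdivrMr// mul1r.
  by rewrite ler_pdivrMr// in h2; nra.
- by rewrite t1 ln1 subrr invr0 subrr lexx ler01.
Qed.

Lemma log_defect_integrable (R : realType) (D : set R) (a b : R) :
  0 <= a -> measurable D -> D `<=` `[a, b] ->
  (@lebesgue_measure R).-integrable D (EFin \o @log_defect R).
Proof.
move=> a0 mD Dab; apply: (@bounded_integrable_itv R D a b 1) => //.
  exact: measurable_log_defect.
move=> x xD; have := Dab x xD; rewrite /= in_itv/= => /andP[ax _].
have /andP[h1 h2] := log_defect_bounds (le_trans a0 ax).
by rewrite ger0_norm.
Qed.

(** The sign s = 1 or -1 treats both sides of the pole at once: ln(s (t - 1)) is an antiderivative
    wherever s (t - 1) > 0. *)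
Lemma Rintegral_inv_FTC (R : realType) (s a b : R) : a <= b ->
  (forall x, a <= x <= b -> 0 < s * (x - 1)) -> s ^+ 2 = 1 ->
  (@lebesgue_measure R).-integrable `[a, b] (EFin \o (fun t : R => (t - 1)^-1)) /\
  \int[@lebesgue_measure R]_(t in `[a, b]) (t - 1)^-1 = ln (s * (b - 1)) - ln (s * (a - 1)).
Proof.
move=> ab sx s2.
have ne0 x : a <= x <= b -> x - 1 != 0.
  by move=> /sx h; apply/eqP => h0; rewrite h0 mulr0 ltxx in h.
have DV x : a <= x <= b -> is_derive x 1 (fun t : R => (t - 1)^-1) (- (x - 1) ^- 2).
  move=> xab.
  have D1 := is_deriveB (is_derive_id (x : R) 1) (is_derive_cst (1 : R) x 1).
  have := @is_deriveV R _ x _ 1 (ne0 x xab) D1.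
  by rewrite subr0 /GRing.scale/= mulr1.
have DF x : a <= x <= b -> is_derive x 1 (fun t : R => ln (s * (t - 1))) ((x - 1)^-1).
  move=> xab; have D1 := is_derive_scale (is_derive1_ln (sx x xab)).
  have D2 := is_deriveB (is_derive_id (x : R) 1) (is_derive_cst (1 : R) x 1).
  have D := @is_derive1_comp R (fun y => ln (s * y)) (fun t => t - 1) x _ _ D1 D2.
  apply: (@is_derive_eq R R R _ _ _ _ _ D).
  rewrite subr0 mulr1 invfM mulrA mulfV ?mul1r//.
  by apply/eqP => s0; move: s2; rewrite s0 expr0n => /eqP; rewrite eq_sym oner_eq0.
have cont : {within `[a, b], continuous (fun t : R => (t - 1)^-1)}.
  apply: derivable_within_continuous => x; rewrite in_itv/= => xab.
  by apply: ex_derive; exact: DV.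
split.
  by apply: continuous_compact_integrable => //; exact: segment_compact.
move: ab; rewrite le_eqVlt => /predU1P[->|ab].
  by rewrite set_itv1 Rintegral_set1 subrr.
have cF x : a <= x <= b -> {for x, continuous (fun t : R => ln (s * (t - 1)))}.
  move=> xab; apply: differentiable_continuous; apply/derivable1_diffP.
  by apply: ex_derive; exact: DF.
have := @continuous_FTC2 R (fun t => (t - 1)^-1) (fun t => ln (s * (t - 1))) a b ab cont.
rewrite /Rintegral => ->; first by rewrite -EFinB.
- split.
  + by move=> x; rewrite in_itv/= => /andP[? ?]; apply: ex_derive; apply: DF; lra.
  + by apply: cvg_at_right_filter; apply: cF; lra.
  + by apply: cvg_at_left_filter; apply: cF; lra.
- move=> x; rewrite in_itv/= => /andP[? ?]; rewrite derive1E.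
  by apply: derive_val; apply: DF; lra.
Qed.

Lemma cut_set_eq (R : realType) (x e : R) : 0 < e -> e < 1 -> e < x - 1 ->
  [set t : R | (0 <= t <= x) && (e <= `|t - 1|)] = `[0, 1 - e] `|` `[1 + e, x].
Proof.
move=> e0 e1 ex; apply/seteqP; split => t /=.
  move=> /andP[/andP[t0 tx]]; rewrite ler_normr => /orP[h|h]; [right|left];
    by rewrite in_itv/=; apply/andP; split; lra.
by move=> [|]; rewrite in_itv/= => /andP[h1 h2]; rewrite ler_normr;
  apply/andP; split; [apply/andP; split; lra|apply/orP; right; lra
                     |apply/andP; split; lra|apply/orP; left; lra].
Qed.

(** The symmetric cut makes the divergent parts cancel: 1 / (t - 1) contributes ln e on the left of
    1 and ln(x - 1) - ln e on the right. *)
Lemma Rintegral_inv_ln_cut (R : realType) (x e : R) : 0 < e -> e < 1 -> e < x - 1 ->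
  \int[@lebesgue_measure R]_(t in [set t : R | (0 <= t <= x) && (e <= `|t - 1|)]) (ln t)^-1
  = ln (x - 1) + \int[@lebesgue_measure R]_(t in `[0, x]) log_defect t
    - \int[@lebesgue_measure R]_(t in `]1 - e, 1 + e[) log_defect t.
Proof.
move=> e0 e1 ex; rewrite cut_set_eq//.
have [mA mB mC] : [/\ measurable (`[0, 1 - e]%classic : set R),
   measurable (`[1 + e, x]%classic : set R) & measurable (`]1 - e, 1 + e[%classic : set R)].
  by split; exact: measurable_itv.
have subA : `[0, 1 - e] `<=` `[0, x] by move=> t; rewrite /= !in_itv/= => /andP[? ?]; lra.
have subB : `[1 + e, x] `<=` `[0, x] by move=> t; rewrite /= !in_itv/= => /andP[? ?]; lra.
have subC : `]1 - e, 1 + e[ `<=` `[0, x] by move=> t; rewrite /= !in_itv/= => /andP[? ?]; lra.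
have iD D : measurable D -> D `<=` `[0, x] ->
    (@lebesgue_measure R).-integrable D (EFin \o @log_defect R).
  by move=> mD; exact: log_defect_integrable.
have dAB : [disjoint `[0, 1 - e]%classic & `[1 + e, x]%classic].
  apply/disj_setPS => t /= [] ; rewrite !in_itv/= => /andP[? ?] /andP[? ?]; lra.
have dAC : [disjoint `[0, 1 - e]%classic & `]1 - e, 1 + e[%classic].
  apply/disj_setPS => t /= [] ; rewrite !in_itv/= => /andP[? ?] /andP[? ?]; lra.
have dACB : [disjoint `[0, 1 - e] `|` `]1 - e, 1 + e[ & `[1 + e, x]%classic].
  apply/disj_setPS => t /= []; rewrite !in_itv/= => -[|] /andP[? ?] /andP[? ?]; lra.
have split0 : `[0, x]%classic = (`[0, 1 - e] `|` `]1 - e, 1 + e[) `|` `[1 + e, x] :> set R.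
  apply/seteqP; split => t /=.
    rewrite !in_itv/= => /andP[t0 tx].
    case: (leP t (1 - e)) => h1; first by left; left; rewrite t0.
    case: (ltP t (1 + e)) => h2; first by left; right.
    by right; rewrite tx.
  by move=> [[]|]; [exact: subA|exact: subC|exact: subB].
have [|||iA IA] := @Rintegral_inv_FTC R (-1) 0 (1 - e);
  [lra|by move=> t /andP[? ?]; lra|by rewrite sqrrN expr1n|].
have [|||iB IB] := @Rintegral_inv_FTC R 1 (1 + e) x;
  [lra|by move=> t /andP[? ?]; lra|by rewrite expr1n|].
have lnE t : (ln t)^-1 = log_defect t + (t - 1)^-1 by rewrite /log_defect subrK.
rewrite Rintegral_setU//; last first.
  apply: (@bounded_integrable_itv R _ 0 x (1 + e^-1)) => //.
  - exact: measurableU.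
  - by move=> t [|]; [exact: subA|exact: subB].
  - by apply: measurable_funTS; exact: (measurableT_comp (@measurable_inv R) (@measurable_ln R)).
  - move=> t tAB; rewrite lnE (le_trans (ler_normD _ _))// lerD//.
      have t0 : 0 <= t by case: tAB; rewrite /= in_itv/= => /andP[? ?]; lra.
      by have /andP[? ?] := log_defect_bounds t0; rewrite ger0_norm.
    have h : e <= `|t - 1|.
      by rewrite ler_normr; case: tAB; rewrite /= in_itv/= => /andP[? ?];
        apply/orP; [right|left]; lra.
    by rewrite normfV lef_pV2 ?posrE// (lt_le_trans e0).
have E D : measurable D -> D `<=` `[0, x] ->
    (@lebesgue_measure R).-integrable D (EFin \o (fun t : R => (t - 1)^-1)) ->
    \int[@lebesgue_measure R]_(t in D) (ln t)^-1 =
    \int[@lebesgue_measure R]_(t in D) log_defect t +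
    \int[@lebesgue_measure R]_(t in D) (t - 1)^-1.
  move=> mD sD i1; rewrite -RintegralD//; last exact: iD.
  by apply: eq_Rintegral => t _; rewrite lnE.
rewrite !E//.
have mAC := measurableU _ _ mA mC.
have iAC : (@lebesgue_measure R).-integrable (`[0, 1 - e] `|` `]1 - e, 1 + e[)
    (EFin \o @log_defect R).
  by apply: iD => // t []; [exact: subA|exact: subC].
have iACB : (@lebesgue_measure R).-integrable
    ((`[0, 1 - e] `|` `]1 - e, 1 + e[) `|` `[1 + e, x]) (EFin \o @log_defect R).
  by rewrite -split0; apply: iD => //; exact: measurable_itv.
have UACB : \int[@lebesgue_measure R]_(t in `[0, x]) log_defect t =
    \int[@lebesgue_measure R]_(t in `[0, 1 - e] `|` `]1 - e, 1 + e[) log_defect t +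
    \int[@lebesgue_measure R]_(t in `[1 + e, x]) log_defect t.
  by rewrite split0; apply: Rintegral_setU.
have UAC : \int[@lebesgue_measure R]_(t in `[0, 1 - e] `|` `]1 - e, 1 + e[) log_defect t =
    \int[@lebesgue_measure R]_(t in `[0, 1 - e]) log_defect t +
    \int[@lebesgue_measure R]_(t in `]1 - e, 1 + e[) log_defect t.
  by apply: Rintegral_setU.
rewrite {}IA {}IB {}UACB {}UAC.
have -> : -1 * (0 - 1) = 1 :> R by ring.
have -> : -1 * (1 - e - 1) = e by ring.
have -> : 1 * (1 + e - 1) = e by ring.
rewrite ln1 mul1r; ring.
Qed.

Lemma li_eq (R : realType) (x : R) : 1 < x ->
  li x = ln (x - 1) + \int[@lebesgue_measure R]_(t in `[0, x]) log_defect t.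
Proof.
move=> x1; rewrite /li; apply: cvg_lim => //.
apply/cvgrPdist_le => eps eps0.
have x10 : 0 < x - 1 by rewrite subr_gt0.
have eps20 : 0 < eps / 2 by rewrite divr_gt0.
near=> e.
have e0 : 0 < e by [].
have e1 : e < 1 by near: e; exact: nbhs_right_lt.
have ex : e < x - 1 by near: e; exact: nbhs_right_lt.
have ee : e < eps / 2 by near: e; exact: nbhs_right_lt.
rewrite Rintegral_inv_ln_cut// opprB addrA [X in `|X - _|]addrC addrK.
have sub : `]1 - e, 1 + e[ `<=` `[0, 2] by move=> t; rewrite /= !in_itv/= => /andP[? ?]; lra.
have iC := @log_defect_integrable R _ 0 2 (lexx _) (measurable_itv _) sub.
have b t : (`]1 - e, 1 + e[%classic : set R) t -> 0 <= log_defect t <= 1.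
  by move=> /sub; rewrite /= in_itv/= => /andP[t0 _]; exact: log_defect_bounds.
rewrite ger0_norm; last by apply: Rintegral_ge0 => t /b /andP[].
apply: (@le_trans _ _ (\int[@lebesgue_measure R]_(t in `]1 - e, 1 + e[) 1)).
  apply: le_Rintegral => //; last by move=> t /b /andP[].
  apply: (@bounded_integrable_itv R _ 0 2 1) => //.
  by move=> t _; rewrite normr1.
rewrite Rintegral_cst; last exact: measurable_itv.
have muC : @lebesgue_measure R `]1 - e, 1 + e[ = (2 * e)%:E.
  rewrite lebesgue_measure_itv /= lte_fin ifT; last by lra.
  by rewrite -EFinB; congr _%:E; ring.
apply: (@le_trans _ _ (1 * fine (@lebesgue_measure R `]1 - e, 1 + e[))) => //.
by rewrite muC /=; lra.
Unshelve. all: by end_near. Qed.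

Lemma is_derive_li (R : realType) (x : R) : 1 < x -> is_derive x 1 (@li R) (ln x)^-1.
Proof.
move=> x1; have x0 : 0 < x by lra.
pose G (y : R) := \int[@lebesgue_measure R]_(t in `[0, y]) log_defect t.
have i1 : (@lebesgue_measure R).-integrable `[0, x + 1] (EFin \o @log_defect R).
  by apply: (@log_defect_integrable R _ 0 (x + 1)) => //; exact: measurable_itv.
have l0 : ln x != 0 by rewrite gt_eqF// ln_gt0.
have x10 : x - 1 != 0 by rewrite gt_eqF//; lra.
have c1 : {for x, continuous (@log_defect R)}.
  have D1 := @is_deriveV R _ x _ 1 l0 (is_derive1_ln x0).
  have D2 := @is_deriveV R (fun t => t - 1) x _ 1 x10
    (is_deriveB (is_derive_id (x : R) 1) (is_derive_cst (1 : R) x 1)).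
  apply: differentiable_continuous; apply/derivable1_diffP.
  by have D := is_deriveB D1 D2; apply: ex_derive; exact: D.
have xu : x < x + 1 by lra.
have [G1 G2] := @continuous_FTC1_closed R (@log_defect R) 0 x (x + 1) xu i1 x0 c1.
have DG : is_derive x 1 G (log_defect x).
  by apply: DeriveDef; [exact: G1|rewrite -derive1E; exact: G2].
have Dln : is_derive x 1 (fun y : R => ln (y - 1)) ((x - 1)^-1).
  have h : 0 < x - 1 by lra.
  have D2 := is_deriveB (is_derive_id (x : R) 1) (is_derive_cst (1 : R) x 1).
  have D := @is_derive1_comp R (@ln R) (fun t => t - 1) x _ _ (is_derive1_ln h) D2.
  by apply: (@is_derive_eq R R R _ _ _ _ _ D); rewrite subr0 mulr1.
apply: (@near_eq_is_derive R R R (fun y => ln (y - 1) + G y)).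
  by near=> y; rewrite li_eq//; near: y; exact: lt_nbhsr.
have D := is_deriveD Dln DG.
by apply: (@is_derive_eq R R R _ _ _ _ _ D); rewrite /log_defect addrC subrK.
Unshelve. all: by end_near. Qed.

Lemma li_continuous_within (R : realType) (a b : R) : 1 < a ->
  {within `[a, b], continuous (@li R)}.
Proof.
move=> a1; apply: derivable_within_continuous => x; rewrite in_itv/= => /andP[ax _].
by apply: ex_derive; apply: is_derive_li; lra.
Qed.

Lemma li_integrable (R : realType) (a b : R) : 1 < a ->
  (@lebesgue_measure R).-integrable `[a, b] (EFin \o @li R).
Proof.
move=> a1; apply: continuous_compact_integrable; first exact: segment_compact.
exact: li_continuous_within.
Qed.

(** * The integral of the remainder: second differences and continuity *)

Lemma prime_pi_le (R : realType) (x y : R) : x <= y -> prime_pi x <= prime_pi y.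
Proof.
move=> xy; rewrite /prime_pi ler_nat.
have h : ((Num.truncn x).+1 <= (Num.truncn y).+1)%N by rewrite ltnS le_truncn.
by rewrite [leqRHS](@big_cat_nat _ _ _ (Num.truncn x).+1)//= leq_addr.
Qed.

Lemma prime_pi_integrable (R : realType) (D : set R) (a b : R) : measurable D ->
  D `<=` `[a, b] -> (@lebesgue_measure R).-integrable D (EFin \o @prime_pi R).
Proof.
move=> mD Dab; apply: (@bounded_integrable_itv R D a b (prime_pi b)) => //.
  apply: measurable_funTS; apply: nondecreasing_measurable => //.
  by move=> x y; exact: prime_pi_le.
move=> x /Dab; rewrite /= in_itv/= => /andP[_ xb].
by rewrite ger0_norm ?ler0n// prime_pi_le.
Qed.

Lemma prime_pi_itv (R : realType) (n : nat) (x : R) : n%:R <= x < n.+1%:R ->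
  prime_pi x = prime_pi (n%:R : R).
Proof. by move=> nx; rewrite /prime_pi natrK (truncn_def nx). Qed.

Lemma prime_piS (R : realType) (n : nat) :
  prime_pi (n.+1%:R : R) = prime_pi (n%:R : R) + (prime n.+1)%:R.
Proof.
rewrite /prime_pi !natrK big_mkcond/= [in RHS]big_mkcond/= big_nat_recr//= natrD.
by case: ifP.
Qed.

Lemma oriented_remainderE (R : realType) (x : R) : 2 <= x ->
  oriented_integral (@remainder R) 2 x =
  \int[@lebesgue_measure R]_(t in `[2, x]) prime_pi t
  - \int[@lebesgue_measure R]_(t in `[2, x]) li t.
Proof.
move=> x2; rewrite /oriented_integral [X in _ - X](_ : _ = 0) ?subr0; last first.
  move: x2; rewrite le_eqVlt => /predU1P[<-|x2]; first by rewrite set_itv1 Rintegral_set1.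
  by rewrite set_itv_ge ?Rintegral_set0// bnd_simp -ltNge.
apply: RintegralB => //.
  by apply: (@prime_pi_integrable R _ 2 x) => //; exact: measurable_itv.
by apply: li_integrable; lra.
Qed.

Lemma Rintegral_prime_pi_step (R : realType) (n : nat) : (2 <= n)%N ->
  \int[@lebesgue_measure R]_(t in `[2, n.+1%:R]) prime_pi t
  - \int[@lebesgue_measure R]_(t in `[2, n%:R]) prime_pi t = prime_pi (n%:R : R).
Proof.
move=> n2; have n2' : 2 <= n%:R :> R by rewrite ler_nat.
have nn : n%:R < n.+1%:R :> R by rewrite ltr_nat.
have I (i : interval R) : [set` i] `<=` `[2, n.+1%:R] ->
    (@lebesgue_measure R).-integrable [set` i] (EFin \o @prime_pi R).
  by apply: prime_pi_integrable; exact: measurable_itv.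
have -> : \int[@lebesgue_measure R]_(t in `[2, n.+1%:R]) prime_pi t
  - \int[@lebesgue_measure R]_(t in `[2, n%:R]) prime_pi t =
  \int[@lebesgue_measure R]_(t in `]n%:R, n.+1%:R]) prime_pi t.
  apply: Rintegral_itvB; rewrite ?bnd_simp//; last exact: ltW.
  exact: I.
(* [prime_pi] may jump at n + 1, so this endpoint is discarded before the integrand is replaced by a
   constant. *)
have -> : \int[@lebesgue_measure R]_(t in `]n%:R, n.+1%:R]) prime_pi t =
  \int[@lebesgue_measure R]_(t in `]n%:R, n.+1%:R[) prime_pi t.
  apply/esym; apply: Rintegral_itv_bndo_bndc; apply: I => t.
  by rewrite /= !in_itv/= => /andP[? ?]; lra.
have -> : \int[@lebesgue_measure R]_(t in `]n%:R, n.+1%:R[) prime_pi t =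
  \int[@lebesgue_measure R]_(t in `]n%:R, n.+1%:R[) prime_pi (n%:R : R).
  apply: eq_Rintegral => t; rewrite inE /= in_itv/= => /andP[t1 t2].
  by apply: prime_pi_itv; rewrite (ltW t1).
rewrite Rintegral_cst; last exact: measurable_itv.
have E : @lebesgue_measure R `]n%:R, n.+1%:R[ = 1%:E.
  rewrite lebesgue_measure_itv /= lte_fin nn -EFinB -natr1; congr _%:E; ring.
transitivity (prime_pi (n%:R : R) * fine (@lebesgue_measure R `]n%:R, n.+1%:R[)) => //.
by rewrite E /= mulr1.
Qed.

(** On [n - 1, n + 1] the derivative 1 / ln t of [li] is at least c = 1 / ln(n + 1). Hence the
    integral of [li] minus c/2 x^2 is convex there, and c/2 x^2 has second difference c. *)
Lemma li_second_difference (R : realType) (n : nat) : (3 < n)%N ->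
  (ln (n.+1%:R : R))^-1 <=
  \int[@lebesgue_measure R]_(t in `[2, n.+1%:R]) li t
  - 2 * \int[@lebesgue_measure R]_(t in `[2, n%:R]) li t
  + \int[@lebesgue_measure R]_(t in `[2, n.-1%:R]) li t.
Proof.
move=> n3; pose M (x : R) := \int[@lebesgue_measure R]_(t in `[2, x]) li t.
pose c : R := (ln (n.+1%:R : R))^-1.
have n4 : 4 <= n%:R :> R by rewrite ler_nat.
have np : n%:R + 1 = n.+1%:R :> R by rewrite natr1.
have nm : n%:R - 1 = n.-1%:R :> R.
  by rewrite -[in LHS](prednK (n := n)) ?(ltn_trans _ n3)// -natr1 addrK.
have DM (x : R) : 2 < x -> is_derive x 1 M (li x).
  move=> x2; have xu : x < x + 1 by lra.
  have i1 := @li_integrable R 2 (x + 1) ltac:(lra).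
  have c1 : {for x, continuous (@li R)}.
    apply: differentiable_continuous; apply/derivable1_diffP.
    by apply: ex_derive; apply: is_derive_li; lra.
  have [h1 h2] := @continuous_FTC1_closed R (@li R) 2 x (x + 1) xu i1 x2 c1.
  by apply: DeriveDef; [exact: h1|rewrite -derive1E; exact: h2].
have Dsq (x k : R) : is_derive x 1 (fun y : R => k * (y * y)) (2 * k * x).
  have D := is_deriveM (is_derive_cst (k : R) x 1)
    (is_deriveM (is_derive_id (x : R) 1) (is_derive_id (x : R) 1)).
  by apply: (@is_derive_eq R R R _ _ _ _ _ D); rewrite /GRing.scale/= !mulr1 mulr0 addr0; ring.
have Dlin (x k : R) : is_derive x 1 (fun y : R => k * y) k.
  have D := is_deriveM (is_derive_cst (k : R) x 1) (is_derive_id (x : R) 1).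
  by apply: (@is_derive_eq R R R _ _ _ _ _ D); rewrite /GRing.scale/= mulr1 mulr0 addr0.
suff : 0 <= (M (n%:R + 1) - c / 2 * ((n%:R + 1) * (n%:R + 1)))
    - 2 * (M n%:R - c / 2 * (n%:R * n%:R))
    + (M (n%:R - 1) - c / 2 * ((n%:R - 1) * (n%:R - 1))).
  rewrite -/c -/(M n.+1%:R) -/(M n%:R) -/(M n.-1%:R) -np -nm; lra.
apply: (@second_difference_ge0 R (fun x => M x - c / 2 * (x * x)) (fun x => li x - c * x)).
  move=> x /andP[x1 x2]; have x3 : 2 < x by lra.
  have D := is_deriveB (DM x x3) (Dsq x (c / 2)).
  by apply: (@is_derive_eq R R R _ _ _ _ _ D); congr (_ - _); field.
move=> x y nx xy yn.
rewrite -lerN2 !opprB.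
apply: (@le_of_derive_le0 R (fun t => c * t - li t) (fun t => c - (ln t)^-1) x y xy).
  move=> t /andP[xt ty]; have t1 : 1 < t by lra.
  exact: (is_deriveB (Dlin t c) (is_derive_li t1)).
move=> t /andP[xt ty]; have t1 : 1 < t by lra.
rewrite subr_le0 lef_pV2 ?posrE ?ln_gt0//; last by rewrite ltr1n; lia.
by rewrite ler_ln ?posrE ?ltr0n//; lra.
Qed.

Lemma oriented_remainder_second_difference (R : realType) (n : nat) : (3 < n)%N ->
  oriented_integral (@remainder R) 2 n.+1%:R
  - 2 * oriented_integral (@remainder R) 2 n%:R
  + oriented_integral (@remainder R) 2 n.-1%:R <= (prime n)%:R - (ln n.+1%:R)^-1.
Proof.
move=> n3.
have h := @li_second_difference R n n3.
have h1 := @Rintegral_prime_pi_step R n ltac:(lia).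
have h2 := @Rintegral_prime_pi_step R n.-1 ltac:(lia).
have h3 := prime_piS R n.-1.
have np : n.-1.+1 = n by lia.
rewrite np in h2 h3.
rewrite !oriented_remainderE ?ler_nat; [|lia|lia|lia].
have L (x y z u v w p q r l : R) : l <= u - 2 * v + w -> x - y = p -> y - z = q ->
    p = q + r -> (x - u) - 2 * (y - v) + (z - w) <= r - l by lra.
exact: L h h1 h2 h3.
Qed.

Lemma oriented_remainder22 (R : realType) : oriented_integral (@remainder R) 2 2 = 0.
Proof. by rewrite oriented_remainderE// set_itv1 !Rintegral_set1 subrr. Qed.

Lemma oriented_remainder_continuous (R : realType) (b : R) : 2 <= b ->
  {within `[2, b], continuous (oriented_integral (@remainder R) 2)}.
Proof.
move=> b2.
have iP : (@lebesgue_measure R).-integrable `[2, b] (EFin \o @prime_pi R).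
  by apply: (@prime_pi_integrable R _ 2 b) => //; exact: measurable_itv.
have iL : (@lebesgue_measure R).-integrable `[2, b] (EFin \o @li R).
  by apply: li_integrable; lra.
have cP := @parameterized_integral_continuous R 2 b (@prime_pi R) b2 iP.
have cL := @parameterized_integral_continuous R 2 b (@li R) b2 iL.
apply: (@subspace_eq_continuous _ _ _ (fun x : R =>
   parameterized_integral lebesgue_measure 2 x (@prime_pi R)
   - parameterized_integral lebesgue_measure 2 x (@li R))).
  move=> x; rewrite inE /= in_itv/= => /andP[x2 _].
  by apply/esym; exact: oriented_remainderE.
by move=> x; apply: cvgB; [exact: cP|exact: cL].
Qed.

(** * Summation by parts and the comparison of primes with integers *)

(** A discrete Green identity: the summand is the increment of the Wronskian w(n-1) E(n) - w(n)
    E(n-1). *)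
Lemma summation_by_parts2 (R : realType) (w E : nat -> R) (a X : nat) :
  (0 < a)%N -> (a <= X.+1)%N ->
  \sum_(a <= n < X.+1) (w n * (E n.+1 - 2 * E n + E n.-1)
                      - E n * (w n.+1 - 2 * w n + w n.-1)) =
  (w X * E X.+1 - w X.+1 * E X) - (w a.-1 * E a - w a * E a.-1).
Proof.
case: a => // a _ aX.
rewrite -(@telescope_sumr R a.+1 X.+1 (fun n => w n.-1 * E n - w n * E n.-1))//.
by apply: eq_bigr => n _ /=; ring.
Qed.

Lemma sum_nat_pairs (R : realType) (h : nat -> R) (k : nat) :
  \sum_(1 <= n < k.*2.+1) h n = \sum_(i < k) (h i.*2.+1 + h i.*2.+2).
Proof.
elim: k => [|k IH]; first by rewrite big_geq// big_ord0.
have S d : \sum_(1 <= n < d.+3) h n = \sum_(1 <= n < d.+1) h n + h d.+1 + h d.+2.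
  by rewrite big_nat_recr// big_nat_recr.
by rewrite big_ord_recr /= -IH doubleS S addrA.
Qed.

Lemma sum_nat_doubles (R : realType) (h : nat -> R) (k : nat) :
  (forall n, (k < n)%N -> h n = 0) ->
  \sum_(1 <= n < k.*2.+1) h n = \sum_(i < k) h i.+1.
Proof.
move=> h0; rewrite (@big_cat_nat _ _ _ k.+1)//=; last by lia.
have -> : \sum_(k.+1 <= n < k.*2.+1) h n = 0.
  by rewrite big_nat big1// => n /andP[kn _]; exact: h0.
rewrite addr0.
by rewrite big_add1 big_mkord.
Qed.

Lemma alt_taper_eq (R : realType) (N : R) (k q : nat) : 0 < N ->
  N ^+ 2 = k.*2%:R -> (0 < q)%N ->
  alt_taper N k q%:R = \sum_(1 <= j < k.*2.+1) taper N (j * q)%:R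
    - 2 * \sum_(1 <= j < k.*2.+1) taper N (2 * (j * q))%:R.
Proof.
move=> N0 Nk q0.
rewrite sum_nat_pairs (@sum_nat_doubles _ (fun j => taper N (2 * (j * q))%:R)); last first.
  by move=> n kn; rewrite taper_eq0// Nk ler_nat; nia.
rewrite mulr_sumr -sumrB /alt_taper; apply: eq_bigr => i _.
rewrite /gap -!natrM.
have -> : (2 * (i.+1 * q) = i.*2.+2 * q)%N by rewrite mulnA; congr (_ * _)%N; lia.
ring.
Qed.

Lemma prime_power_sum_alt_taper_le (R : realType) (N : R) (k : nat) : 0 < N ->
  N ^+ 2 = k.*2%:R -> (8 <= k)%N ->
  prime_power_sum k.*2.+1 (fun q => alt_taper N k q%:R) <=
  306 + 2 * ln 2 * (3 / 4 * N + (2 * N)^-1).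
Proof.
move=> N0 Nk k8.
pose f (n : nat) := taper N n%:R; pose g (n : nat) := taper N (2 * n)%:R.
have f0 n : (k.*2.+1 <= n)%N -> f n = 0.
  by move=> h; rewrite /f taper_eq0// Nk ler_nat; lia.
have g0 n : (k < n)%N -> g n = 0.
  by move=> h; rewrite /g taper_eq0// Nk ler_nat; lia.
have -> : prime_power_sum k.*2.+1 (fun q => alt_taper N k q%:R) =
   prime_power_sum k.*2.+1 (fun q => \sum_(1 <= j < k.*2.+1) f (j * q)%N)
   - 2 * prime_power_sum k.*2.+1 (fun q => \sum_(1 <= j < k.*2.+1) g (j * q)%N).
  rewrite -prime_power_sumZ /prime_power_sum -sumrB; apply: eq_bigr => p pp.
  rewrite -sumrB; apply: eq_bigr => e _.
  by rewrite -mulrBr alt_taper_eq// expn_gt0 prime_gt0.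
rewrite !prime_power_sum_multiples//; last by move=> n h; apply: g0; lia.
rewrite sum_nat_pairs (@sum_nat_doubles _ (fun n => ln n%:R * g n)); last first.
  by move=> n h; rewrite g0// mulr0.
(* Writing ln m = ln(2m) - ln 2 in the subtracted sum flips the sign of the even terms and leaves 2
   ln 2 times the sum of [taper] over even integers. *)
have -> : \sum_(i < k) (ln i.*2.+1%:R * f i.*2.+1 + ln i.*2.+2%:R * f i.*2.+2)
    - 2 * \sum_(i < k) ln i.+1%:R * g i.+1 =
  \sum_(i < k) (ln i.*2.+1%:R * f i.*2.+1 - ln i.*2.+2%:R * f i.*2.+2)
  + 2 * ln 2 * \sum_(i < k) taper N i.*2.+2%:R.
  rewrite !mulr_sumr -sumrB -big_split/=; apply: eq_bigr => i _.
  have e2 : (2 * i.+1 = i.*2.+2)%N by lia.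
  rewrite /g /f e2 -e2 natrM lnM ?posrE ?ltr0n//; ring.
apply: lerD; first exact: sum_pairs_ln_taper.
apply: ler_wpM2l; last exact: sum_even_taper.
by rewrite mulr_ge0// ln_ge0// ler1n.
Qed.

(** For q <= M = N / 2 both q^2 and 2 q^2 lie below N^2, so the first gap at q^2 is (2 - sqrt 2) / q
    - q^2 / N^3. The last term is at most 1 / (8 q), and 2 - sqrt 2 >= 11/20 leaves more than
    2/5. *)
Lemma alt_taper_sqr_ge (R : realType) (M k q : nat) : (0 < q)%N -> (q <= M)%N ->
  2 / 5 / q%:R <= alt_taper (2 * M%:R : R) k.+1 (q ^ 2)%N%:R.
Proof.
move=> q0 qM; set N : R := 2 * M%:R.
have q0' : 0 < q%:R :> R by rewrite ltr0n.
have qM' : q%:R <= M%:R :> R by rewrite ler_nat.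
have N0 : 0 < N by rewrite /N; lra.
have qq0 : 0 < (q ^ 2)%N%:R :> R by rewrite ltr0n expn_gt0 q0.
apply: le_trans (alt_taper_ge_gap k N0 qq0).
rewrite /gap mul1r natrX.
have qN : 2 * q%:R <= N by rewrite /N; lra.
have q2 : (q%:R : R) ^+ 2 <= N ^+ 2 / 4.
  have : (2 * q%:R : R) ^+ 2 <= N ^+ 2 by apply: lerXn2r; rewrite ?nnegrE //; lra.
  rewrite exprMn; lra.
have q3 : (q%:R : R) ^+ 3 <= N ^+ 3 / 8.
  have : (2 * q%:R : R) ^+ 3 <= N ^+ 3 by apply: lerXn2r; rewrite ?nnegrE //; lra.
  rewrite exprMn; lra.
have p2 : 0 < (q%:R : R) ^+ 2 by rewrite exprn_gt0.
rewrite !taper_eq//; try lra.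
rewrite sqrtr_sqr ger0_norm ?ler0n// sqrtrM// sqrtr_sqr ger0_norm ?ler0n//.
have s2 : 0 < Num.sqrt (2 : R) by rewrite sqrtr_gt0.
have s2E : (Num.sqrt (2 : R))^-1 ^+ 2 = 2^-1 by rewrite exprVn sqr_sqrtr.
have s2V : 0 < (Num.sqrt (2 : R))^-1 by rewrite invr_gt0.
have sb : (Num.sqrt (2 : R))^-1 <= 3 / 4 - 1 / 40 by rewrite leNgt; apply/negP => h; nra.
have -> : 2 / (Num.sqrt 2 * q%:R) = 2 * (Num.sqrt 2)^-1 / q%:R :> R.
  by field; rewrite !gt_eqF.
have c : (q%:R : R) ^+ 2 / N ^+ 3 <= 1 / 8 / q%:R.
  rewrite ler_pdivrMr ?exprn_gt0// mulrAC ler_pdivlMr// -exprSr; lra.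
have d := ler_wpM2r (ltW (_ : 0 < (q%:R : R)^-1)) sb.
have {}d := d ltac:(by rewrite invr_gt0).
have y0 : 0 <= (q%:R : R)^-1 by rewrite invr_ge0 ler0n.
have L (x y z u : R) : 0 <= y -> x <= 1 / 8 * y -> z * y <= (3 / 4 - 1 / 40) * y ->
    2 / 5 * y <= 2 * y + x - u - (2 * z * y + 2 * x - u) by lra.
by rewrite -[2 * _ ^+ 2 / _]mulrA; exact: L y0 c d.
Qed.

Lemma sum_inv_pow32_le (R : realType) (a b : nat) : (1 < a)%N -> (a <= b)%N ->
  \sum_(a <= n < b) 2 / Num.sqrt n%:R / n%:R <= 4 :> R.
Proof.
move=> a1 ab.
have T := @telescope_sumr R a b (fun n => - (4 / Num.sqrt n.-1%:R)) ab.
apply: (@le_trans _ _ (- (4 / Num.sqrt b.-1%:R) - - (4 / Num.sqrt (a.-1%:R : R)))); last first.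
  have h1 : 0 <= 4 / Num.sqrt (b.-1%:R : R) by rewrite divr_ge0// sqrtr_ge0.
  have h2 : 4 / Num.sqrt (a.-1%:R : R) <= 4.
    rewrite ler_pdivrMr ?sqrtr_gt0 ?ltr0n//; last by lia.
    rewrite ler_peMr// -[leLHS]sqrtr1 ler_wsqrtr// ler1n; lia.
  lra.
rewrite -T; apply: ler_sum_nat => n /andP[an _] /=.
have n0 : 0 < n%:R :> R by rewrite ltr0n; lia.
have m0 : 0 < n.-1%:R :> R by rewrite ltr0n; lia.
have E : n%:R = n.-1%:R + 1 :> R by rewrite natr1 prednK//; lia.
have z0 : 0 < Num.sqrt (n%:R : R) by rewrite sqrtr_gt0.
have x0 : 0 < Num.sqrt (n.-1%:R : R) by rewrite sqrtr_gt0.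
have zE := sqr_sqrtr (ltW n0); have xE := sqr_sqrtr (ltW m0).
have xz : Num.sqrt (n.-1%:R : R) <= Num.sqrt n%:R by rewrite ler_wsqrtr// E lerDl.
have L (x z : R) : 0 < x -> x <= z -> z ^+ 2 = x ^+ 2 + 1 ->
    2 / z / z ^+ 2 <= - (4 / z) - - (4 / x).
  move=> {}x0 {}xz {}E; have {}z0 : 0 < z by lra.
  have -> : - (4 / z) - - (4 / x) = 4 * (z ^+ 2 - x ^+ 2) / (x * z * (x + z)).
    by field; rewrite !gt_eqF ?addr_gt0.
  have -> : z ^+ 2 - x ^+ 2 = 1 by rewrite E; ring.
  have -> : 2 / z / z ^+ 2 = 4 / (z * z * (z + z)) by field; rewrite ?gt_eqF ?addr_gt0.
  rewrite mulr1 ler_pM2l// lef_pV2 ?posrE ?mulr_gt0 ?addr_gt0//.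
  have h0 : 0 <= x * z by rewrite mulr_ge0// ltW.
  have h1 : x * z <= z * z by rewrite ler_wpM2r// ltW.
  by apply: ler_pM => //; lra.
have := L _ _ x0 xz; rewrite zE xE; apply; exact: E.
Qed.

(** Replacing ln n / ln(n + 1) by 1 costs at most 2 n^(-3/2) per term, in all at most 4. The terms
    below a add up to at most 2 a. *)
Lemma sum_ln_weight_ge (R : realType) (V : nat -> R) (a X : nat) : (2 < a)%N ->
  (a <= X)%N -> (forall n, (0 < n)%N -> 0 <= V n <= 2 / Num.sqrt n%:R) ->
  1 <= ln (a%:R : R) ->
  \sum_(1 <= n < X.+1) V n - 2 * a%:R - 4 <=
  \sum_(a <= n < X.+1) ln n%:R * V n * (ln n.+1%:R)^-1.
Proof.
move=> a2 aX VE la.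
rewrite (@big_cat_nat _ _ _ a)//=; [|lia|lia].
have h1 : \sum_(1 <= n < a) V n <= 2 * a%:R.
  apply: (@le_trans _ _ (\sum_(1 <= n < a) 2)).
    apply: ler_sum_nat => n /andP[n0 _]; have /andP[_ h] := VE n n0.
    apply: (le_trans h); rewrite ler_pdivrMr ?sqrtr_gt0 ?ltr0n// ler_peMr//.
    by rewrite -[leLHS]sqrtr1 ler_wsqrtr// ler1n.
  by rewrite sumr_const_nat -[leLHS]mulr_natr ler_wpM2l// ler_nat leq_subr.
have h2 := @sum_inv_pow32_le R a X.+1 ltac:(lia) ltac:(lia).
suff : \sum_(a <= n < X.+1) V n - \sum_(a <= n < X.+1) 2 / Num.sqrt n%:R / n%:R <=
   \sum_(a <= n < X.+1) ln n%:R * V n * (ln n.+1%:R)^-1.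
  have L (x y z u : R) : x <= 2 * a%:R -> z <= 4 -> y - z <= u -> x + y - 2 * a%:R - 4 <= u.
    by lra.
  exact: L.
rewrite -sumrB; apply: ler_sum_nat => n /andP[an _].
have n0 : (0 < n)%N by lia.
have n0' : 0 < n%:R :> R by rewrite ltr0n.
have n1' : 0 < n.+1%:R :> R by rewrite ltr0n.
have /andP[V0 V2] := VE n n0.
have ll : 1 <= ln (n.+1%:R : R).
  by apply: (le_trans la); rewrite ler_ln ?posrE ?ltr0n ?ler_nat//; lia.
have d := ln_sub_le n0' n1'.
have dE : (n.+1%:R - n%:R) / n%:R = n%:R^-1 :> R.
  by rewrite -natr1 addrAC subrr add0r mul1r.
rewrite {}dE in d.
have i0 : 0 <= (n%:R : R)^-1 by rewrite invr_ge0 ler0n.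
have l0 : 0 < ln (n.+1%:R : R) by lra.
rewrite ler_pdivlMr//.
have h3 : V n * (ln n.+1%:R - ln n%:R) <= 2 / Num.sqrt n%:R * n%:R^-1.
  apply: (@le_trans _ _ (V n * n%:R^-1)); first by rewrite ler_wpM2l.
  by rewrite ler_wpM2r.
have h4 : 0 <= 2 / Num.sqrt (n%:R : R) * n%:R^-1.
  by rewrite mulr_ge0// divr_ge0// sqrtr_ge0.
have h5 : 2 / Num.sqrt (n%:R : R) * n%:R^-1 <= 2 / Num.sqrt (n%:R : R) * n%:R^-1 * ln n.+1%:R.
  by rewrite ler_peMr.
have L (v s l m : R) : v * (l - m) <= s -> s <= s * l -> (v - s) * l <= m * v by lra.
exact: L h3 h5.
Qed.

(** The squares q^2 with q <= M give at least 2 / (5 q) each, so the Mertens bound yields the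
    logarithmic gain. With N = 2 M, [k.+1] is N^2 / 2. *)
Lemma prime_power_sum_alt_taper_ge (R : realType) (M k : nat) : (0 < M)%N ->
  (2 * (M * M) = k.+1)%N ->
  \sum_(p < k.+1.*2.+1 | prime p) ln p%:R * alt_taper (2 * M%:R) k.+1 p%:R
    + 2 / 5 * (ln M%:R - 1) <=
  prime_power_sum k.+1.*2.+1 (fun q => alt_taper (2 * M%:R : R) k.+1 q%:R).
Proof.
move=> M0 Mk; pose V (q : nat) := alt_taper (2 * M%:R : R) k.+1 q%:R.
have N0 : 0 < 2 * M%:R :> R by rewrite mulr_gt0// ltr0n.
have V0 q : (0 < q)%N -> 0 <= V q by move=> q0; rewrite alt_taper_ge0// ltr0n.
apply: le_trans (@prime_power_sum_ge R k.+1.*2.+1 M.+1 V V0 isT _); last by nia.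
apply: lerD => //.
apply: (@le_trans _ _ (2 / 5 * prime_power_sum M.+1 (fun q => (q <= M)%N%:R / q%:R))).
  by apply: ler_wpM2l => //; exact: prime_power_sum_inv_ge.
rewrite -prime_power_sumZ; apply: prime_power_sum_le => q q0.
case: (leqP q M) => qM; last by rewrite mul0r mulr0 V0// expn_gt0 q0.
by rewrite mulrA mulr1; exact: alt_taper_sqr_ge.
Qed.

(** The order of choices is what matters: [a] marks where convexity starts, [K] is computed from
    [a], and only then is [M] taken large, so no constant depends on [M]. *)
Lemma unbounded_below (R : realType) (F : nat -> R) :
  (forall n, (3 < n)%N ->
     F n.+1 - 2 * F n + F n.-1 <= (prime n)%:R - (ln n.+1%:R)^-1) ->
  forall C, exists2 n, (2 <= n)%N & F n < - C.
Proof.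
move=> F2 C; apply: contrapT => H.
have FC n : (2 <= n)%N -> 0 <= F n + C.
  move=> n2; rewrite -[C]opprK subr_ge0 leNgt; apply/negP => h.
  by apply: H; exists n.
have archi (x : R) : exists2 m : nat, (4 <= m)%N & x <= ln m%:R.
  exists ((Num.truncn (expR x)).+1 + 4)%N; first by lia.
  rewrite -[leLHS]expRK ler_ln ?posrE ?expR_gt0 ?ltr0n//.
  by rewrite (le_trans (ltW (truncnS_gt _)))// ler_nat leq_addr.
have [a a4 la] := archi 60.
pose E n := F n + C.
(* 5/2 inverts the coefficient 2/5 of [ln M], and 400 exceeds 306 + 2 + 6 + 4 + 2/5, the accumulated
   constants. The other terms are the omitted head of the sum and the boundary term at [a]. *)
pose K : R := 5 / 2 * (400 + 2 * a%:R + 2 * a%:R * E a).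
have [M0 M04 lM0] := archi (K + 1).
pose M := (M0 + a)%N.
have lM : K < ln M%:R.
  apply: (@lt_le_trans _ _ (ln M0%:R)); first by lra.
  by rewrite ler_ln ?posrE ?ltr0n ?ler_nat /M; lia.
have M8 : (8 <= M)%N by rewrite /M; lia.
have [k Mk] : exists k, (2 * (M * M) = k.+1)%N.
  by exists (2 * (M * M)).-1; rewrite prednK//; nia.
have k8 : (8 <= k.+1)%N by rewrite -Mk; nia.
have Mpos : (0 < M)%N by lia.
have [a1 a2 a3] : [/\ (0 < a)%N, (1 < a)%N & (2 < a)%N] by split; lia.
have a10 : (0 < a.-1)%N by lia.
have a11 : (1 < a.-1)%N by lia.
pose X := k.+1.*2.
have aX : (a < X)%N by rewrite /X -Mk /M; nia.
have X1 : (0 < X.-1)%N by rewrite /X.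
have aXS : (a <= X.+1)%N by exact: leqW (ltnW aX).
have la1 : 1 <= ln (a%:R : R) by lra.
pose N : R := 2 * M%:R.
have M1 : 1 <= M%:R :> R by rewrite ler1n; lia.
have N1 : 1 <= N by rewrite /N; lra.
have N0 : 0 < N by lra.
have NX : N ^+ 2 = X%:R.
  by rewrite /N /X -Mk -natrM -natrX; congr _%:R; nia.
pose V (n : nat) := alt_taper N k.+1 n%:R.
pose w (n : nat) := ln n%:R * V n.
have V0 n : (0 < n)%N -> 0 <= V n by move=> n0; rewrite alt_taper_ge0// ltr0n.
have V2 n : (0 < n)%N -> 0 <= V n <= 2 / Num.sqrt n%:R.
  move=> n0; have n0' : 0 < n%:R :> R by rewrite ltr0n.
  by rewrite V0//= (le_trans (alt_taper_le _ N0 n0'))// taper_le.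
have VX n : (X <= n)%N -> V n = 0.
  move=> Xn; apply: big1 => i _; rewrite /gap !taper_eq0 ?subrr// NX -natrM ler_nat; nia.
have w0 n : (0 < n)%N -> 0 <= w n.
  by move=> n0; rewrite mulr_ge0 ?V0// ln_ge0// ler1n.
have wa : w a.-1 <= 2 * a%:R.
  have a10' : 0 < a.-1%:R :> R by rewrite ltr0n.
  have /andP[_ h] := @ln_taper_le R N a.-1 N0 a10.
  apply: (@le_trans _ _ (ln a.-1%:R * taper N a.-1%:R)).
    by rewrite ler_wpM2l ?alt_taper_le// ln_ge0// ler1n.
  by apply: (le_trans h); rewrite ler_pM2l// ler_nat leq_pred.
have w2 n : (a <= n)%N -> (n <= X)%N -> 0 <= w n.+1 - 2 * w n + w n.-1.
  (* The convexity estimate stops at n + 1 <= N^2 = X. At n = X the weight vanishes at X and X + 1,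
     and only w(X - 1) >= 0 remains. *)
  move=> an; rewrite leq_eqVlt => /predU1P[->|nX].
    rewrite /w (VX X)// (VX X.+1)// !mulr0 subrr add0r.
    exact: w0.
  have n0 : (0 < n)%N := leq_trans a1 an.
  have n4 : 2 <= n%:R :> R by rewrite ler_nat (leq_trans _ an).
  have ln60 : 60 <= ln (n%:R : R).
    by apply: (le_trans la); rewrite ler_ln ?posrE ?ltr0n ?ler_nat.
  have nN : n%:R + 1 <= N ^+ 2 by rewrite NX natr1 ler_nat.
  have := @ln_alt_taper_second_difference R N n%:R k N0 n4 ln60 nN.
  have -> : n%:R + 1 = n.+1%:R :> R by rewrite natr1.
  have -> : n%:R - 1 = n.-1%:R :> R by rewrite -[in LHS](prednK n0) -natr1 addrK.
  by [].
have S := @summation_by_parts2 R w E a X a1 aXS.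
(* The boundary terms at X vanish with [V]. At [a] only w(a - 1) E(a) enters negatively, and [wa]
   bounds it independently of N. *)
have S1 : - (2 * a%:R * E a) <= \sum_(a <= n < X.+1) w n * (E n.+1 - 2 * E n + E n.-1).
  have h1 : 0 <= \sum_(a <= n < X.+1) E n * (w n.+1 - 2 * w n + w n.-1).
    rewrite big_nat; apply: sumr_ge0 => n /andP[an nX].
    by apply: mulr_ge0; [exact: FC (leq_trans a2 an)|exact: w2].
  move: S; rewrite sumrB /w (VX X)// (VX X.+1)// !mulr0 !mul0r subrr sub0r => S.
  have h2 : w a.-1 * E a <= 2 * a%:R * E a by rewrite ler_wpM2r// FC.
  have h3 : 0 <= w a * E a.-1 by rewrite mulr_ge0 ?w0 ?FC.
  have L (x y z u c : R) : x - y = - (z - u) -> 0 <= y -> z <= c -> 0 <= u -> - c <= x by lra.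
  exact: L S h1 h2 h3.
have S2 : \sum_(a <= n < X.+1) w n * (E n.+1 - 2 * E n + E n.-1) <=
    \sum_(a <= n < X.+1) w n * (prime n)%:R
    - \sum_(a <= n < X.+1) ln n%:R * V n * (ln n.+1%:R)^-1.
  rewrite -sumrB; apply: ler_sum_nat => n /andP[an _].
  rewrite -/(w n) -mulrBr; apply: ler_wpM2l; first exact: w0 (leq_trans a1 an).
  have -> : E n.+1 - 2 * E n + E n.-1 = F n.+1 - 2 * F n + F n.-1 by rewrite /E; ring.
  exact: F2 (leq_trans a4 an).
have S3 : \sum_(a <= n < X.+1) w n * (prime n)%:R <=
    \sum_(p < X.+1 | prime p) ln p%:R * V p.
  rewrite [leRHS]big_mkcond /= -(big_mkord xpredT (fun n => if prime n then w n else 0)).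
  rewrite [leRHS](@big_cat_nat _ _ _ a)//=.
  rewrite -[leLHS]add0r; apply: lerD.
    by apply: sumr_ge0 => n _; case: ifP => // pn; apply: w0; exact: prime_gt0.
  by apply: ler_sum => n _; case: ifP; rewrite ?mulr1 ?mulr0.
have S4 := @sum_ln_weight_ge R V a X a3 (ltnW aX) V2 la1.
have S5 := @prime_power_sum_alt_taper_ge R M k Mpos Mk.
have S6 := @prime_power_sum_alt_taper_le R N k.+1 N0 NX k8.
have S7 := @sum_alt_taper_ge R N k.+1 N1 NX.
have ln2 : 0 <= ln (2 : R) <= 1.
  rewrite ln_ge0 ?ler1n//= -[leRHS]expRK ler_ln ?posrE ?expR_gt0//.
  by have := expR_ge1Dx (1 : R); lra.
have N2 : 1 <= 2 * N by lra.
have N' : (2 * N)^-1 <= 1 by rewrite invf_le1// (lt_le_trans ltr01).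
move: S5 S6; rewrite -/N -/X => S5 S6.
have L (e d1 p h v t l m : R) :
  - (2 * a%:R * E a) <= d1 -> d1 <= p - h -> p <= t -> v - 2 * a%:R - 4 <= h ->
  t + 2 / 5 * (m - 1) <= l -> l <= 306 + 2 * ln 2 * (3 / 4 * N + e) ->
  3 / 2 * N * ln 2 - 6 <= v -> ln 2 * e <= 1 -> K < m -> False.
  by rewrite /K; lra.
apply: (L (2 * N)^-1 _ _ _ _ _ _ _ S1 S2 S3 S4 S5 S6 S7 _ lM).
case/andP: ln2 => l1 l2.
have i0 : 0 <= (2 * N)^-1 by rewrite invr_ge0 (le_trans ler01).
by rewrite -[leRHS]mulr1 ler_pM.
Qed.

Theorem mainTheorem1 (R : realType) :
  riemann_hypothesis R ->
  exists2 Delta0 : R, 0 < Delta0 &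
  forall Delta : R, 0 < Delta < Delta0 ->
  exists N O1 : R -> R,
  [/\ forall delta : R, 0 < delta < Delta -> 0 < N delta,
      {within `]0, Delta[, continuous O1},
      [bounded O1 delta | delta in `]0, Delta[] &
      forall delta : R, 0 < delta < Delta ->
        oriented_integral (@remainder R) 2 (N delta)
          = - (expR (9 / 2) / delta) + O1 delta].
Proof.
move=> _; exists 1 => // Delta /andP[Delta0 _].
have /choice[N HN] (delta : R) : exists y, 0 < delta ->
    0 < y /\ oriented_integral (@remainder R) 2 y = - (expR (9 / 2) / delta).
  (* The choice ranges over all real [delta]; the value 0 for [delta <= 0] is a default. *)
  have [d0|d0] := ltP 0 delta; last by exists 0.
  have [n n2 Fn] := @unbounded_below R
    (fun n => oriented_integral (@remainder R) 2 n%:R)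
    (@oriented_remainder_second_difference R) (expR (9 / 2) / delta).
  have n2' : 2 <= n%:R :> R by rewrite ler_nat.
  have C0 : - (expR (9 / 2) / delta) <= 0 by rewrite oppr_le0 divr_ge0 ?expR_ge0 ?ltW.
  have [|y] := IVT (v := - (expR (9 / 2) / delta)) n2' (oriented_remainder_continuous n2').
    by rewrite oriented_remainder22 ge_min le_max C0 (ltW Fn) orbT.
  rewrite in_itv/= => /andP[y2 _] yE; exists y => _; split=> //.
  exact: lt_le_trans y2.
exists N, (fun=> 0); split.
- by move=> delta /andP[d0 _]; have [] := HN delta d0.
- by move=> x; exact: cvg_cst.
- by exists 0; split=> [|M M0 x _] /=; [exact: num_real|rewrite normr0 ltW].
- by move=> delta /andP[d0 _]; rewrite addr0; have [] := HN delta d0.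
Qed.
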